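(* Let $G(W=(U,V),E)$ be a finite bipartite graph and let $P\ge 1$. The two-phase algorithm PBNG for wing decomposition, i.e. coarse-grained decomposition (PBNG CD) followed by fine-grained decomposition (PBNG FD), run on $G$ with $P$ partitions, correctly computes the wing numbers of all edges: for every $e\in E(G)$, the value output by PBNG for $e$ equals the wing number $\theta_e$ of $e$ in $G$.
   Context: **Wing numbers.** $G(W=(U,V),E)$ is a finite simple bipartite graph with vertex set $W=U\sqcup V$ and edge set $E$. A butterfly is a subgraph isomorphic to $K_{2,2}$ (a 4-cycle); $\bowtie_e^G$ is the number of butterflies of $G$ containing edge $e$. For an integer $k\ge 0$, a $k$-wing of $G$ is a subgraph $H\subseteq G$ induced on an edge set $E(H)\subseteq E(G)$ such that (i) each $e\in E(H)$ is contained in at least $k$ butterflies of $H$, (ii) any two edges of $H$ are connected by a series of butterflies of $H$, and (iii) $H$ is maximal, i.e. no other $k$-wing subsumes $H$. The wing number $\theta_e$ of $e$ is the largest $k$ such that $e$ lies in some $k$-wing. $\theta^{max}_E$ is the maximum wing number. Edges carry distinct integer IDs. **Blooms and BE-Index.** Rank all vertices by a fixed total order (priority) in which vertices of larger degree have higher priority. A maximal priority $k$-bloom $B$ ($k\ge2$) is a $(2,k)$-biclique of $G$ (one side, the dominant set, has exactly two vertices; the other side has $k$ vertices) such that the highest-priority vertex of $B$ lies in the dominant set, and $B$ is maximal under inclusion among such bicliques; concretely, for a dominant pair $\{x,y\}$ on the same side of $G$ with $y$ of higher priority, the non-dominant side is the set of all common neighbours of $x$ and $y$ of lower priority than $y$.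 Each non-dominant vertex has exactly two incident edges $e,e'$ in $B$, called twins: $twin(e,B)=e'$. The BE-Index $I$ of $G$ is the bipartite graph with vertex sets $U(I)=$ set of all maximal priority blooms and $V(I)=E(G)$, with a link $(e,B)\in E(I)$ iff $e\in E(B)$, labelled by $twin(e,B)$; each $B$ stores a bloom number $k_B(I)$, initially $k$ (the number of non-dominant vertices). $N_e(I)$ and $N_B(I)$ denote neighbourhoods in $I$. **PBNG CD.** Input $G$, $P$. Initially the support is $\bowtie_e=\bowtie_e^G$ for all $e$, $I$ is the BE-Index of $G$, $E_{rem}=E(G)$, $E_1=\dots=E_P=\emptyset$, $\theta(1)=0$, $i=1$. While $E_{rem}\ne\emptyset$ and $i\le P$: 1. set $\bowtie^{init}_e\leftarrow\bowtie_e$ for all $e\in E_{rem}$; 2. set $\theta(i+1)=\theta_{ub}+1$, where $\theta_{ub}$ is the least value $\theta$ among the supports of edges in $E_{rem}$ with $\sum_{e\in E_{rem},\,\bowtie_e\le\theta}\bowtie_e\ge tgt$, $tgt$ being a target workload (which may be readjusted for each $i$); 3. let $S=\{e\in E_{rem}:\theta(i)\le\bowtie_e<\theta(i+1)\}$; while $S\neq\emptyset$: move $S$ from $E_{rem}$ to $E_i$, perform PARALLEL_UPDATE$(S,\theta(i))$, and recompute $S=\{e\in E_{rem}:\theta(i)\le\bowtie_e<\theta(i+1)\}$ (each pass is one peeling iteration); 4. $i\leftarrow i+1$. The targets are such that the ranges $R_i=[\theta(i),\theta(i+1))$ together cover $[0,\theta^{max}_E]$. Partitions never reached stay empty. PARALLEL_UPDATE$(S,\theta)$: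 for all $e\in S$ in parallel (atomic support updates) and each $B\in N_e(I)$, put $e_t=twin(e,B)$; if $e_t\notin S$ or $ID(e_t)<ID(e)$, then set $\bowtie_{e_t}\leftarrow\max(\theta,\bowtie_{e_t}-(k_B(I)-1))$, delete the links $(e,B),(e_t,B)$ from $I$, increment $count[B]$ (initially 0), and for every $e'\in N_B(I)$ with $twin(e',B)\notin S$ set $\bowtie_{e'}\leftarrow\max(\theta,\bowtie_{e'}-1)$. After all $e\in S$ are processed, set $k_B(I)\leftarrow k_B(I)-count[B]$ for every $B$. **PBNG FD.** Input: the BE-Index $I$ of the original graph $G$, the partitions $E_1,\dots,E_P$ and $\bowtie^{init}$. Write $p(e)$ for the index with $e\in E_{p(e)}$. For each $i$ a BE-Index $I_i$ is built: it contains exactly those links $(e,B)\in E(I)$ with $p(e)=i$ and $p(twin(e,B))\ge i$, and bloom number $k_B(I_i)=$ the number of twin pairs $\{e,e_t\}$ of $B$ with $p(e)\ge i$ and $p(e_t)\ge i$. Supports are initialized to $\bowtie_e=\bowtie^{init}_e$. Each partition $E_i$ is processed by a single thread (different partitions concurrently and independently): while $E_i\ne\emptyset$, pick $e\in E_i$ of minimum support, output $\bowtie_e$ as the wing number of $e$ (call this value $\theta$), remove $e$ from $E_i$, and for each $B\in N_e(I_i)$: with $e_t=twin(e,B)$, set $\bowtie_{e_t}\leftarrow\max(\theta,\bowtie_{e_t}-(k_B(I_i)-1))$, delete links $(e,B),(e_t,B)$ from $I_i$, set $k_B(I_i)\leftarrow k_B(I_i)-1$, and set $\bowtie_{e'}\leftarrow\max(\theta,\bowtie_{e'}-1)$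 for all $e'\in N_B(I_i)$. Only supports of edges of $E_i$ are modified while processing $E_i$. *)

(* Defs.v *)
From HB Require Import structures.
From mathcomp Require Import all_boot all_order all_algebra.

Set Implicit Arguments.
Unset Strict Implicit.
Unset Printing Implicit Defensive.

Section Wing.

(* A finite simple bipartite graph with sides U, V is its edge set
   E : {set U * V}; an edge is a pair (u, v).  A butterfly is given by its set
   of four edges, which determines it since K_{2,2} has no isolated vertex. *)
Variables (U V : finType) (E : {set U * V}).
Local Notation edge := (U * V)%type.
Implicit Types (H : {set edge}) (e f : edge) (b : {set edge}).

Definition is_butterfly b : bool :=
  [exists A : {set U}, [exists C : {set V},
    [&& #|A| == 2, #|C| == 2 & b == setX A C]]].

Definition butterflies H : {set {set edge}} :=
  [set b | is_butterfly b & b \subset H].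

Definition butterflies_at H e : {set {set edge}} :=
  [set b in butterflies H | e \in b].

Definition share_butterfly H : rel edge :=
  fun e f => [exists b in butterflies H, (e \in b) && (f \in b)].

Definition wing_cond (k : nat) : pred {set edge} := fun H =>
  [&& H \subset E,
      [forall e in H, k <= #|butterflies_at H e|]
    & [forall e in H, forall f in H, connect (share_butterfly H) e f]].

Definition is_wing (k : nat) H : bool := maxset (wing_cond k) H.

Definition in_wing (k : nat) e : bool := [exists H, is_wing k H && (e \in H)].

(* The largest k with in_wing k e; the bound on k is harmless, see
   wing_numberP. *)
Definition wing_number e : nat :=
  \max_(k < #|butterflies E|.+1 | in_wing k e) k.

Lemma wing_numberP e : e \in E ->
  in_wing (wing_number e) e /\ forall k, in_wing k e -> k <= wing_number e.
Proof.
move=> eE.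
have bound k : in_wing k e -> k < #|butterflies E|.+1.
  case/existsP=> H /andP[/maxsetp /and3P[HE /forall_inP deg _] eH].
  rewrite ltnS (leq_trans (deg e eH)) //; apply/subset_leq_card/subsetP => b.
  rewrite !inE => /andP[/andP[-> bH] _] /=; exact: subset_trans bH HE.
have w0 : in_wing 0 e.
  have [|H Hmax eH] := @maxset_exists _ (wing_cond 0) [set e].
    rewrite /wing_cond sub1set eE /=; apply/andP; split; first exact/forall_inP.
    by apply/forall_inP=> x /set1P-> ; apply/forall_inP=> y /set1P->.
  by apply/existsP; exists H; rewrite /is_wing Hmax -sub1set.
split.
  rewrite /wing_number.
  have [|j jw ->] :=
    @eq_bigmax_cond _ [pred k : 'I_#|butterflies E|.+1 | in_wing k e] val.
    by apply/card_gt0P; exists ord0.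
  exact: jw.
move=> k kw.
exact: (@leq_bigmax_cond _ _ (fun j : 'I__ => val j) (Ordinal (bound k kw))).
Qed.

Definition theta_max : nat := \max_(e in E) wing_number e.

Local Notation vertex := (U + V)%type.

Definition adj (x y : vertex) : bool :=
  match x, y with
  | inl u, inr v | inr v, inl u => (u, v) \in E
  | _, _ => false
  end.

Definition degree (x : vertex) : nat := #|[set y | adj x y]|.

Definition incident e (x : vertex) : bool := (x == inl e.1) || (x == inr e.2).

(* A total order on the vertices is given by an injective rank. *)
Definition degree_priority (prio : vertex -> nat) : Prop :=
  injective prio /\ forall x y, degree x < degree y -> prio x < prio y.

End Wing.

Section PBNG.

Variables (U V : finType) (E : {set U * V}).
Local Notation edge := (U * V)%type.
Local Notation vertex := (U + V)%type.
Variables (prio : vertex -> nat) (ID : edge -> int).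

(* A bloom is the pair (dominant set, non-dominant set). *)
Local Notation bloom := ({set vertex} * {set vertex})%type.
Implicit Types (e f : edge) (B : bloom) (S : {set edge}).

Definition bloom_vertices B : {set vertex} := B.1 :|: B.2.

Definition priority_bloom B : bool :=
  [&& #|B.1| == 2, 2 <= #|B.2|,
      [forall x in B.1, forall z in B.2, adj E x z]
    & [exists y in B.1, forall z in bloom_vertices B, prio z <= prio y]].

(* Inclusion of bicliques, as subgraphs of the bipartite graph, is inclusion
   of their vertex sets. *)
Definition max_priority_bloom B : bool :=
  priority_bloom B &&
  [forall B', priority_bloom B' ==>
     (bloom_vertices B \subset bloom_vertices B') ==> (B' == B)].

Definition bloom_edges B : {set edge} :=
  [set e | (inl e.1 \in B.1) && (inr e.2 \in B.2)
        || (inr e.2 \in B.1) && (inl e.1 \in B.2)].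

Definition twins B e f : bool :=
  [&& e \in bloom_edges B, f \in bloom_edges B, e != f
    & [exists z in B.2, incident e z && incident f z]].

Definition twin e B : edge := odflt e [pick f | twins B e f].

(* The label of a link (e, B) is always twin e B, hence is not stored. *)
Record be_index := BEIndex {
  links : {set edge * bloom};
  bloom_number : bloom -> nat }.

Definition BE_Index : be_index := BEIndex
  [set l | max_priority_bloom l.2 & l.1 \in bloom_edges l.2]
  (fun B => #|B.2|).

Definition blooms_of (L : {set edge * bloom}) e : {set bloom} :=
  [set B | (e, B) \in L].

Definition edges_of (L : {set edge * bloom}) B : {set edge} :=
  [set e | (e, B) \in L].

Definition upd (A : eqType) (T : Type) (f : A -> T) (a : A) (t : T) : A -> T :=
  fun x => if x == a then t else f x.

Definition decr (supp : edge -> nat) (theta : nat) e (c : nat) : edge -> nat :=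
  upd supp e (maxn theta (supp e - c)).

(* PARALLEL_UPDATE is run by one thread per edge of S.  The pending code of a
   thread is a list of instructions; each instruction is atomic and the
   instructions of distinct threads are interleaved arbitrarily.  Start, Visit
   and Scan unfold into further instructions of the same thread, and "for each"
   loops may enumerate their range in any order. *)
Inductive instr :=
  | Start                          (* for each B in N_e(I) *)
  | Visit of bloom                 (* the test on twin(e,B) *)
  | Decr_twin of bloom
  | Delete of edge & bloom
  | Incr_count of bloom
  | Scan of bloom                  (* for each e' in N_B(I), twin not in S *)
  | Decr_one of edge.

Record shared := Shared {
  sh_supp : edge -> nat;
  sh_links : {set edge * bloom};
  sh_count : bloom -> nat }.

Section ParallelUpdate.

(* Bloom numbers are only changed once all threads are done, so they are a
   constant num during the interleaving. *)
Variables (S : {set edge}) (theta : nat) (num : bloom -> nat).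

(* exec e c s new s': thread e executes c in s, giving s' and the instructions
   new to be run next by e. *)
Inductive exec e : instr -> shared -> seq instr -> shared -> Prop :=
  | ExecStart s bs :
      perm_eq bs (enum (blooms_of (sh_links s) e)) ->
      exec e Start s (map Visit bs) s
  | ExecVisit s B :
      exec e (Visit B) s
        (if (twin e B \notin S) || (ID (twin e B) < ID e)%R
         then [:: Decr_twin B; Delete e B; Delete (twin e B) B;
                  Incr_count B; Scan B]
         else [::]) s
  | ExecDecrTwin s B :
      exec e (Decr_twin B) s [::]
        (Shared (decr (sh_supp s) theta (twin e B) (num B - 1))
                (sh_links s) (sh_count s))
  | ExecDelete s f B :
      exec e (Delete f B) s [::]
        (Shared (sh_supp s) (sh_links s :\ (f, B)) (sh_count s))
  | ExecIncrCount s B :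
      exec e (Incr_count B) s [::]
        (Shared (sh_supp s) (sh_links s)
                (upd (sh_count s) B (sh_count s B).+1))
  | ExecScan s B fs :
      perm_eq fs
        (enum [set f in edges_of (sh_links s) B | twin f B \notin S]) ->
      exec e (Scan B) s (map Decr_one fs) s
  | ExecDecrOne s f :
      exec e (Decr_one f) s [::]
        (Shared (decr (sh_supp s) theta f 1) (sh_links s) (sh_count s)).

Inductive interleave : (edge -> seq instr) -> shared -> shared -> Prop :=
  | InterleaveDone pool s :
      (forall e, pool e = [::]) -> interleave pool s s
  | InterleaveStep pool s e c cs new s1 s2 :
      pool e = c :: cs -> exec e c s new s1 ->
      interleave (upd pool e (new ++ cs)) s1 s2 -> interleave pool s s2.

End ParallelUpdate.

Inductive parallel_update S (theta : nat) (supp : edge -> nat) (I : be_index) :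
    (edge -> nat) -> be_index -> Prop :=
  ParallelUpdate s :
    interleave S theta (bloom_number I)
      (fun e => if e \in S then [:: Start] else [::])
      (Shared supp (links I) (fun=> 0)) s ->
    parallel_update S theta supp I (sh_supp s)
      (BEIndex (sh_links s) (fun B => bloom_number I B - sh_count s B)).

(* The partitions are stored as cd_part : cd_part e is p(e), and 0 as long as e
   is in no partition. *)
Record cd_state := CDState {
  cd_supp : edge -> nat;
  cd_index : be_index;
  cd_rem : {set edge};
  cd_part : edge -> nat;
  cd_init : edge -> nat;
  cd_theta : nat -> nat;
  cd_i : nat }.

Definition cd_partition (s : cd_state) (i : nat) : {set edge} :=
  [set e in E | cd_part s e == i].

Definition cd_start : cd_state := CDState
  (fun e => #|butterflies_at E e|) BE_Index E (fun=> 0) (fun=> 0) (fun=> 0) 1.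

Definition workload (s : cd_state) (t : nat) : nat :=
  \sum_(e in cd_rem s | cd_supp s e <= t) cd_supp s e.

Definition is_theta_ub (s : cd_state) (tgt : rat) (ub : nat) : Prop :=
  [/\ exists2 e, e \in cd_rem s & cd_supp s e = ub,
      (tgt <= (workload s ub)%:R)%R
    & forall e, e \in cd_rem s ->
        (tgt <= (workload s (cd_supp s e))%:R)%R -> ub <= cd_supp s e].

Definition open_stage (s : cd_state) (ub : nat) : cd_state := CDState
  (cd_supp s) (cd_index s) (cd_rem s) (cd_part s)
  (fun e => if e \in cd_rem s then cd_supp s e else cd_init s e)
  (upd (cd_theta s) (cd_i s).+1 ub.+1) (cd_i s).

Definition next_stage (s : cd_state) : cd_state := CDState
  (cd_supp s) (cd_index s) (cd_rem s) (cd_part s) (cd_init s) (cd_theta s)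
  (cd_i s).+1.

Definition active (s : cd_state) : {set edge} :=
  [set e in cd_rem s | cd_theta s (cd_i s) <= cd_supp s e
                                           < cd_theta s (cd_i s).+1].

Inductive peel : cd_state -> cd_state -> Prop :=
  | PeelDone s : active s = set0 -> peel s s
  | PeelIter s supp I s' :
      active s != set0 ->
      parallel_update (active s) (cd_theta s (cd_i s)) (cd_supp s) (cd_index s)
        supp I ->
      peel (CDState supp I (cd_rem s :\: active s)
              (fun e => if e \in active s then cd_i s else cd_part s e)
              (cd_init s) (cd_theta s) (cd_i s)) s' ->
      peel s s'.

Variable P : nat.

Inductive cd_loop (tgt : nat -> rat) : cd_state -> cd_state -> Prop :=
  | CDDone s : (cd_rem s == set0) || (P < cd_i s) -> cd_loop tgt s s
  | CDStage s ub s1 s' :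
      cd_rem s != set0 -> cd_i s <= P -> is_theta_ub s (tgt (cd_i s)) ub ->
      peel (open_stage s ub) s1 -> cd_loop tgt (next_stage s1) s' ->
      cd_loop tgt s s'.

(* tgt i is the target workload in use for partition i. *)
Definition PBNG_CD (tgt : nat -> rat) (cd : cd_state) : Prop :=
  cd_loop tgt cd_start cd.

(* The ranges R_j that exist are those of the stages j < cd_i. *)
Definition ranges_cover (cd : cd_state) : Prop :=
  forall t, t <= theta_max E ->
    exists2 j, 1 <= j < cd_i cd & cd_theta cd j <= t < cd_theta cd j.+1.

Record fd_state := FDState {
  fd_supp : edge -> nat;
  fd_index : be_index;
  fd_rem : {set edge};
  fd_out : edge -> option nat }.

Definition fd_BE_Index (part : edge -> nat) (i : nat) : be_index := BEIndex
  [set l in links BE_Index | (part l.1 == i) && (i <= part (twin l.1 l.2))]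
  (fun B => #|[set [set e; twin e B]
                | e in bloom_edges B & (i <= part e) && (i <= part (twin e B))]|).

Definition fd_start (cd : cd_state) (i : nat) : fd_state := FDState
  (cd_init cd) (fd_BE_Index (cd_part cd) i) (cd_partition cd i) (fun=> None).

(* The body of the loop over the blooms B of the peeled edge e; Ei is the
   whole partition being processed, whose supports alone may be modified. *)
Definition fd_update (Ei : {set edge}) (theta : nat) e
    (s : (edge -> nat) * be_index) B : (edge -> nat) * be_index :=
  let: (supp, idx) := s in
  let et := twin e B in
  let supp1 :=
    if et \in Ei then decr supp theta et (bloom_number idx B - 1) else supp in
  let L := links idx :\ (e, B) :\ (et, B) in
  (fun f => if f \in edges_of L B then maxn theta (supp1 f - 1) else supp1 f,
   BEIndex L (upd (bloom_number idx) B (bloom_number idx B - 1))).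

Inductive fd_loop (Ei : {set edge}) : fd_state -> fd_state -> Prop :=
  | FDDone s : fd_rem s = set0 -> fd_loop Ei s s
  | FDPeel s e bs supp I s' :
      e \in fd_rem s ->
      (forall f, f \in fd_rem s -> fd_supp s e <= fd_supp s f) ->
      perm_eq bs (enum (blooms_of (links (fd_index s)) e)) ->
      (supp, I) = foldl (fd_update Ei (fd_supp s e) e)
                        (fd_supp s, fd_index s) bs ->
      fd_loop Ei (FDState supp I (fd_rem s :\ e)
                    (upd (fd_out s) e (Some (fd_supp s e)))) s' ->
      fd_loop Ei s s'.

(* Partitions are processed independently, each with its own supports and
   index; out e is the value output for e, if any. *)
Definition PBNG_FD (cd : cd_state) (out : edge -> option nat) : Prop :=
  (forall i, 1 <= i <= P ->
    exists2 s, fd_loop (cd_partition cd i) (fd_start cd i) s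
             & {in cd_partition cd i, out =1 fd_out s}) /\
  (forall e, ~~ (1 <= cd_part cd e <= P) -> out e = None).

End PBNG.

(* Main.v *)
Require Import Defs.
From mathcomp Require Import all_boot all_order all_algebra.
From mathcomp Require Import zify.

Set Implicit Arguments.
Unset Strict Implicit.
Unset Printing Implicit Defensive.

(* The wing number of e is at least k exactly when e lies in a k-core, an edge set
   each of whose edges is in at least k butterflies of the set: the butterfly
   component of an edge in a k-core satisfies the connectivity condition.

   Each butterfly lies in exactly one maximal priority bloom B, where it consists
   of two pairs of twins.  So the number of butterflies of H at e is the sum of
   (number of pairs of B in H) - 1 over the blooms B having the pair of e in H, and
   both update procedures subtract exactly the butterflies lost by removing
   edges, up to the truncation max(theta, _).

   CD: at stage i the support of a remaining edge is max(theta(i), its butterfly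
   count among the remaining edges).  An edge peeled during the stage has count
   below theta(i+1), so it is in no theta(i+1)-core, while after the stage
   the remaining edges form a theta(i+1)-core.  Hence E_i consists of the edges
   with wing number in R_i, and E_i \cup E_(i+1) \cup ... is a theta(i)-core.

   FD: this is sequential peeling of E_i on top of the fixed core of later
   edges.  If the last output is c, every k-core with k > c is still
   alive, which bounds wing numbers from above; when the output grows to m, the
   alive edges form an m-core, since edges in later partitions have count at
   least theta(i+1), which bounds them from below. *)

(** * Cores and blooms *)

Section Cores.

Variables (U V : finType) (E : {set U * V}).
Local Notation edge := (U * V)%type.
Implicit Types (H K : {set edge}) (e f : edge).

Definition butterfly_count H e : nat := #|butterflies_at H e|.

Definition is_core k K : Prop :=
  K \subset E /\ {in K, forall f, k <= butterfly_count K f}.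

Lemma butterfly_count_sub H K e :
  H \subset K -> butterfly_count H e <= butterfly_count K e.
Proof.
move=> sHK; apply/subset_leq_card/subsetP=> b; rewrite !inE.
by case/andP=> /andP[-> /subset_trans->].
Qed.

Lemma share_butterflyP H e f :
  reflect (exists b, [/\ is_butterfly b, b \subset H, e \in b & f \in b])
          (share_butterfly H e f).
Proof.
apply: (iffP existsP) => [[b /andP[]]|[b [bb bH eb fb]]].
  by rewrite inE => /andP[bb bH] /andP[eb fb]; exists b.
by exists b; rewrite inE bb bH eb fb.
Qed.

Lemma share_butterfly_sym H : symmetric (share_butterfly H).
Proof. by move=> e f; apply: eq_existsb => b; rewrite (andbC (e \in b)). Qed.

(* The butterfly component of e in a k-core satisfies all conditions of a
   k-wing but maximality. *)
Lemma core_in_wing k K e : is_core k K -> e \in K -> in_wing E k e.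
Proof.
move=> [KE degK] eK.
pose C := [set f in K | connect (share_butterfly K) e f].
have bC b x : is_butterfly b -> b \subset K -> x \in b ->
    connect (share_butterfly K) e x -> b \subset C.
  move=> bb bK xb ex; apply/subsetP=> y yb; rewrite inE (subsetP bK) //=.
  by apply: connect_trans ex (connect1 _); apply/share_butterflyP; exists b.
have conC f : f \in C -> connect (share_butterfly C) e f.
  rewrite inE => /andP[_ /connectP[p pp ->]]; apply/connectP; exists p => //.
  (* The start of the path is generalised to any edge reachable from [e]: the butterfly of each step
     then contains a reachable edge, so it lies in [C]. *)
  have : connect (share_butterfly K) e e by [].
  elim: p {1 3 4}e pp => //= y p IHp x /andP[xy pp] ex.
  rewrite IHp ?andbT //; last exact: connect_trans ex (connect1 xy).
  case/share_butterflyP: xy => b [bb bK xb yb].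
  by apply/share_butterflyP; exists b; split=> //; apply: bC ex.
have [|H Hmax CH] := @maxset_exists _ (wing_cond E k) C.
  apply/and3P; split.
  - by apply: subset_trans KE; apply/subsetP=> x; rewrite inE => /andP[].
  - apply/forall_inP=> f; rewrite inE => /andP[fK ef].
    apply: leq_trans (degK f fK) _; apply/subset_leq_card/subsetP=> b.
    rewrite !inE => /andP[/andP[bb bK] fb]; rewrite bb fb andbT /=.
    exact: bC ef.
  - apply/forall_inP=> f fC; apply/forall_inP=> g gC.
    apply: connect_trans (conC g gC).
    by rewrite (sym_connect_sym (@share_butterfly_sym C)); apply: conC.
apply/existsP; exists H; rewrite /is_wing Hmax (subsetP CH) //.
by rewrite inE eK connect0.
Qed.

Lemma core_wing_number k K e : is_core k K -> e \in K -> k <= wing_number E e.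
Proof.
move=> cK eK; have eE := subsetP cK.1 e eK.
by have [_] := wing_numberP eE; apply; apply: core_in_wing eK.
Qed.

Lemma wing_number_core e :
  e \in E -> exists2 K, is_core (wing_number E e) K & e \in K.
Proof.
move=> /wing_numberP[/existsP[K /andP[/maxsetp /and3P[KE /forall_inP deg _] eK]]].
by move=> _; exists K.
Qed.

End Cores.

(** * Twins and butterflies inside one bloom *)

Section Blooms.

Variables (U V : finType) (E : {set U * V}) (prio : U + V -> nat).
Local Notation edge := (U * V)%type.
Local Notation vertex := (U + V)%type.
Local Notation bloom := ({set vertex} * {set vertex})%type.
Implicit Types (H S : {set edge}) (e f g : edge) (B : bloom) (x y z : vertex).

(** A boolean names a side of the graph, so that one argument covers dominant sets in [U] and in
    [V]; below, [c] is the dominant side. *)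
Definition side x : bool := if x is inl _ then true else false.

Definition endpoint (c : bool) e : vertex := if c then inl e.1 else inr e.2.

Lemma side_endpoint c e : side (endpoint c e) = c.
Proof. by case: c. Qed.

Lemma endpoint_inj c e f :
  endpoint c e = endpoint c f -> endpoint (~~ c) e = endpoint (~~ c) f -> e = f.
Proof. by case: c e f => -[? ?] [? ?] /= [->] [->]. Qed.

Lemma endpoint_surj c x z : side x = c -> side z = ~~ c ->
  exists e, endpoint c e = x /\ endpoint (~~ c) e = z.
Proof.
by case: c x z => -[u|v] // [u'|v'] // _ _; [exists (u, v') | exists (u', v)].
Qed.

Lemma adj_endpoint c e : adj E (endpoint c e) (endpoint (~~ c) e) = (e \in E).
Proof. by case: c e => -[]. Qed.

Lemma adj_side x z : adj E x z -> side z = ~~ side x.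
Proof. by case: x z => ? []. Qed.

Lemma is_butterflyP c (b : {set edge}) :
  reflect (exists X Y : {set vertex},
    [/\ #|X| = 2, #|Y| = 2, {in X, forall x, side x = c},
        {in Y, forall y, side y = ~~ c}
      & forall e, (e \in b) = (endpoint c e \in X) && (endpoint (~~ c) e \in Y)])
  (is_butterfly b).
Proof.
have cardl (A : {set U}) : #|[set (inl a : vertex) | a in A]| = #|A|.
  by rewrite card_imset // => ? ? [].
have cardr (A : {set V}) : #|[set (inr a : vertex) | a in A]| = #|A|.
  by rewrite card_imset // => ? ? [].
have inl_inj : injective (@inl U V) by move=> ? ? [].
have inr_inj : injective (@inr U V) by move=> ? ? [].
apply: (iffP existsP).
  case=> A /existsP[C /and3P[/eqP cA /eqP cC /eqP ->]].
  exists (if c then [set inl a | a in A] else [set inr a | a in C]).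
  exists (if c then [set inr a | a in C] else [set inl a | a in A]).
  case: c => /=; split; rewrite ?cardl ?cardr //.
  - by move=> x /imsetP[? _ ->].
  - by move=> x /imsetP[? _ ->].
  - by move=> [u v]; rewrite in_setX /= !mem_imset.
  - by move=> x /imsetP[? _ ->].
  - by move=> x /imsetP[? _ ->].
  - by move=> [u v]; rewrite in_setX /= !mem_imset // andbC.
case=> X [Y [cX cY sX sY bE]].
exists (if c then [set u | inl u \in X] else [set u | inl u \in Y]).
apply/existsP.
exists (if c then [set v | inr v \in Y] else [set v | inr v \in X]).
have onl (Z : {set vertex}) : {in Z, forall x, side x = true} ->
    #|[set u | inl u \in Z]| = #|Z|.
  move=> sZ; rewrite -cardl; apply: eq_card => -[u|v].
    by rewrite mem_imset // inE.
  by apply/imsetP/idP=> [[]//|/sZ].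
have onr (Z : {set vertex}) : {in Z, forall x, side x = false} ->
    #|[set u | inr u \in Z]| = #|Z|.
  move=> sZ; rewrite -cardr; apply: eq_card => -[u|v].
    by apply/imsetP/idP=> [[]//|/sZ].
  by rewrite mem_imset // inE.
case: c bE sX sY => /= bE sX sY; rewrite ?onl ?onr ?cX ?cY //=.
  by apply/eqP/setP=> -[u v]; rewrite bE in_setX !inE.
by apply/eqP/setP=> -[u v]; rewrite bE in_setX !inE andbC.
Qed.

(** Both vertex sets are nonempty and completely joined, which forces each onto a single side and
    leaves one disjunct of [bloom_edges]. *)
Lemma priority_bloomP B : priority_bloom E prio B ->
  exists c, [/\ {in B.1, forall x, side x = c}, {in B.2, forall z, side z = ~~ c}
  & forall e, (e \in bloom_edges B) =
              (endpoint c e \in B.1) && (endpoint (~~ c) e \in B.2)].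
Proof.
case/and4P=> /eqP c1 c2 /forall_inP adjB _.
have [x0 x0B] : exists x, x \in B.1 by apply/card_gt0P; rewrite c1.
have [z0 z0B] : exists z, z \in B.2 by apply/card_gt0P; apply: leq_trans c2.
have adjP x z : x \in B.1 -> z \in B.2 -> side z = ~~ side x.
  by move=> xB zB; apply: adj_side; apply: (forall_inP (adjB x xB)).
have s2 : {in B.2, forall z, side z = ~~ side x0}.
  by move=> z zB; apply: adjP.
have s1 : {in B.1, forall x, side x = side x0}.
  by move=> x xB; apply: negb_inj; rewrite -(adjP x z0) // s2.
exists (side x0); split=> // e; rewrite inE /endpoint.
case: (side x0) s1 s2 => s1 s2 /=.
  by case: (boolP (inr e.2 \in B.1)) => [/s1 //|_]; rewrite orbF.
by case: (boolP (inl e.1 \in B.1)) => [/s1 //|_].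
Qed.

Section OneBloom.

Variable B : bloom.
Hypothesis bloomB : priority_bloom E prio B.

Lemma bloom_edges_sub : bloom_edges B \subset E.
Proof.
have [c [_ _ eB]] := priority_bloomP bloomB.
apply/subsetP=> e; rewrite eB => /andP[e1 e2].
case/and4P: bloomB => _ _ /forall_inP/(_ _ e1)/forall_inP/(_ _ e2) + _.
by rewrite adj_endpoint.
Qed.

Lemma twinsP c e f :
  {in B.1, forall x, side x = c} -> {in B.2, forall z, side z = ~~ c} ->
  twins B e f = [&& e \in bloom_edges B, f \in bloom_edges B, e != f
                  & endpoint (~~ c) e == endpoint (~~ c) f].
Proof.
move=> s1 s2; rewrite /twins.
have [c' [s1' s2' eB]] := priority_bloomP bloomB.
have cc : c' = c.
  case/and4P: bloomB => /eqP c1 _ _ _.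
  have [x xB] : exists x, x \in B.1 by apply/card_gt0P; rewrite c1.
  by rewrite -(s1 x xB) s1'.
rewrite {}cc {s1' s2' c'} in eB.
case: (boolP (e \in _)) => //= eeB; case: (boolP (f \in _)) => //= feB.
case: (e != f) => //=.
have inc g z : g \in bloom_edges B -> z \in B.2 ->
    incident g z = (z == endpoint (~~ c) g).
  rewrite eB => /andP[g1 _] zB; have {s1 s2 eB eeB feB} sz := s2 z zB.
  rewrite /incident /endpoint; case: c sz {g1} => /= sz; case: z sz {zB} => //= v _.
  by rewrite orbF.
apply/existsP/eqP => [[z /andP[zB]]|ef].
  by rewrite !inc // => /andP[/eqP <- /eqP].
have := eeB; rewrite eB => /andP[_ zB].
by exists (endpoint (~~ c) e); rewrite zB !inc // eqxx {1}ef eqxx.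
Qed.

Lemma twins_exists e : e \in bloom_edges B -> exists f, twins B e f.
Proof.
have [c [s1 s2 eB]] := priority_bloomP bloomB => eeB.
have := eeB; rewrite eB => /andP[e1 e2].
case/and4P: bloomB => /eqP c1 _ _ _.
have : 0 < #|B.1 :\ endpoint c e|.
  by rewrite -(ltn_add2l (endpoint c e \in B.1)) -cardsD1 c1 e1.
case/card_gt0P=> x; rewrite !inE => /andP[xe xB].
have [f [fx fz]] := @endpoint_surj c x (endpoint (~~ c) e) (s1 x xB) (side_endpoint _ _).
exists f; rewrite (twinsP _ _ s1 s2) eeB fz eqxx andbT eB fx xB fz e2 /=.
by apply: contraNneq xe => ->; rewrite fx.
Qed.

Lemma twins_uniq e f g : twins B e f -> twins B e g -> f = g.
Proof.
have [c [s1 s2 eB]] := priority_bloomP bloomB.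
rewrite !(twinsP _ _ s1 s2) => /and4P[eeB fB ef /eqP zef] /and4P[_ gB eg /eqP zeg].
apply: (@endpoint_inj c); last by rewrite -zef.
have ne h : e != h -> endpoint (~~ c) e = endpoint (~~ c) h ->
    endpoint c e != endpoint c h.
  by move=> eh zeh; apply: contraNneq eh => xeh; apply/eqP/(@endpoint_inj c).
have xef := ne f ef zef; have xeg := ne g eg zeg.
apply/eqP; apply: contraT => fg.
case/and4P: bloomB => /eqP c1 _ _ _.
(* If [f] and [g] differed, these would be three distinct vertices in a dominant set of size 2. *)
have sub : [set endpoint c e; endpoint c f; endpoint c g] \subset B.1.
  apply/subsetP=> x; rewrite !inE -orbA.
  by case/or3P=> /eqP ->; move: eeB fB gB; rewrite !eB; do 3 case/andP=> ? _.
have := subset_leq_card sub; rewrite c1 -setUA cardsU1 cards2 !inE fg.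
by rewrite negb_or xef xeg.
Qed.

Lemma twins_sym e f : twins B e f = twins B f e.
Proof.
have [c [s1 s2 _]] := priority_bloomP bloomB.
by rewrite !(twinsP _ _ s1 s2) andbCA (eq_sym e) (eq_sym (endpoint _ e)).
Qed.

Lemma twin_twins e : e \in bloom_edges B -> twins B e (twin e B).
Proof.
rewrite /twin => /twins_exists[f ef]; case: pickP => [//|/(_ f)].
by rewrite ef.
Qed.

Lemma twin_eq e f : twins B e f -> twin e B = f.
Proof.
move=> ef; apply: (twins_uniq _ ef); apply: twin_twins.
by case/and4P: ef.
Qed.

Lemma twin_edge e : e \in bloom_edges B -> twin e B \in bloom_edges B.
Proof. by case/twin_twins/and4P. Qed.

Lemma twin_neq e : e \in bloom_edges B -> twin e B != e.
Proof. by case/twin_twins/and4P; rewrite eq_sym. Qed.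

Lemma twinK e : e \in bloom_edges B -> twin (twin e B) B = e.
Proof. by move=> eB; apply: twin_eq; rewrite twins_sym; apply: twin_twins. Qed.

Lemma twin_endpoint c e : {in B.1, forall x, side x = c} ->
  {in B.2, forall z, side z = ~~ c} -> e \in bloom_edges B ->
  endpoint (~~ c) (twin e B) = endpoint (~~ c) e.
Proof.
move=> s1 s2 eB; have := twin_twins eB.
by rewrite (twinsP _ _ s1 s2) => /and4P[_ _ _ /eqP].
Qed.

Lemma two_pairs_butterfly e f : e \in bloom_edges B -> f \in bloom_edges B ->
  f \notin [set e; twin e B] ->
  is_butterfly ([set e; twin e B] :|: [set f; twin f B]).
Proof.
have [c [s1 s2 eB]] := priority_bloomP bloomB => eeB feB fN.
apply/(is_butterflyP c); exists B.1.
exists [set endpoint (~~ c) e; endpoint (~~ c) f].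
have inpair g h : g \in bloom_edges B -> (h \in [set g; twin g B]) =
    (h \in bloom_edges B) && (endpoint (~~ c) h == endpoint (~~ c) g).
  move=> gB; apply/idP/andP=> [|[hB /eqP hg]].
    rewrite in_set2 => /orP[]/eqP->; first by rewrite gB eqxx.
    by rewrite twin_edge // (twin_endpoint s1 s2) // eqxx.
  rewrite in_set2; case: (eqVneq h g) => //= hNg; apply/eqP/esym/twin_eq.
  by rewrite (twinsP _ _ s1 s2) gB hB eq_sym hNg hg eqxx.
case/and4P: bloomB => /eqP c1 _ _ _.
move: (eeB) (feB); rewrite !eB => /andP[_ e2] /andP[_ f2].
split=> //.
- rewrite cards2; have := fN; rewrite inpair // feB /= eq_sym.
  by move=> ->.
- by move=> y; rewrite !inE => /orP[]/eqP->; rewrite side_endpoint.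
move=> g; rewrite in_setU !inpair // eB !inE -andb_orr.
case: (_ \in B.1) => //=; case: eqP => [->|_]; rewrite ?e2 //=.
by case: eqP => [->|_]; rewrite ?f2 ?andbF //.
Qed.

(* Four edges are two dominant vertices times two others, so a butterfly inside
   a bloom has the dominant set of the bloom as one of its sides. *)
Lemma butterfly_dominant c (b : {set edge}) :
  {in B.1, forall x, side x = c} -> {in B.2, forall z, side z = ~~ c} ->
  is_butterfly b -> b \subset bloom_edges B ->
  exists2 Y : {set vertex}, #|Y| = 2 /\ Y \subset B.2 &
  forall e, (e \in b) = (endpoint c e \in B.1) && (endpoint (~~ c) e \in Y).
Proof.
move=> s1 s2 /(is_butterflyP c)[X [Y [cX cY sX sY bE]]] bB.
have [x0 x0X] : exists x, x \in X by apply/card_gt0P; rewrite cX.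
have [y0 y0Y] : exists x, x \in Y by apply/card_gt0P; rewrite cY.
case/and4P: (bloomB) => /eqP c1 _ _ _.
have bB' x y : x \in X -> y \in Y -> (x \in B.1) && (y \in B.2).
  move=> xX yY; have [e [ex ey]] := endpoint_surj (sX x xX) (sY y yY).
  have /(subsetP bB) : e \in b by rewrite bE ex ey xX.
  have [c' [s1' s2' ->]] := priority_bloomP bloomB.
  case: (eqVneq c' c) => [->|]; rewrite ?ex ?ey // => cc.
  have {cc} : c' = ~~ c by case: c' c cc {s1 s2 s1' s2' bE sX sY ex ey} => [] [].
  by move=> ->; rewrite ey => /andP[/s1]; rewrite (sY y yY); case: (c).
have sXB : X \subset B.1.
  by apply/subsetP=> x xX; case/andP: (bB' x y0 xX y0Y).
have {sXB}XB : X = B.1 by apply/eqP; rewrite eqEcard sXB cX c1.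
exists Y; first split=> //; last by rewrite -XB.
by apply/subsetP=> y yY; case/andP: (bB' x0 y x0X yY).
Qed.

Lemma butterfly_twin (b : {set edge}) e : is_butterfly b -> b \subset bloom_edges B ->
  e \in b -> twin e B \in b.
Proof.
have [c [s1 s2 eB]] := priority_bloomP bloomB => bb bB eb.
have [Y _ bE] := butterfly_dominant s1 s2 bb bB.
have eeB := subsetP bB e eb; have := twin_edge eeB.
rewrite eB bE (twin_endpoint s1 s2) // => /andP[-> _].
by move: eb; rewrite bE => /andP[].
Qed.

Lemma twin_pair e f : e \in bloom_edges B -> f \in [set e; twin e B] ->
  [set f; twin f B] = [set e; twin e B].
Proof. by move=> eB; rewrite !inE => /orP[]/eqP-> //; rewrite twinK // setUC. Qed.

(** The map [pr] sends a non-dominant vertex to the two bloom edges at it, which are twins; thus the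
    initial bloom number counts twin pairs. *)
Lemma card_bloom_pairs :
  #|B.2| = #|[set [set e; twin e B] | e in bloom_edges B]|.
Proof.
have [c [s1 s2 eB]] := priority_bloomP bloomB.
case/and4P: bloomB => /eqP c1 _ _ _.
have [x0 x0B] : exists x, x \in B.1 by apply/card_gt0P; rewrite c1.
have xe z : z \in B.2 -> exists e, e \in bloom_edges B /\ endpoint (~~ c) e = z.
  move=> zB; have [e [ex ez]] := endpoint_surj (s1 x0 x0B) (s2 z zB).
  by exists e; rewrite eB ex ez x0B zB.
pose pr z := bloom_edges B :&: [set e | endpoint (~~ c) e == z].
have prE e : e \in bloom_edges B -> [set e; twin e B] = pr (endpoint (~~ c) e).
  move=> eeB; apply/setP=> f; rewrite in_set2 in_setI in_set.
  apply/idP/andP=> [/orP[]/eqP->|[fB /eqP fz]].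
  - by rewrite eqxx.
  - by rewrite (twin_endpoint s1 s2) // eqxx; split=> //; apply: twin_edge.
  - case: (eqVneq f e) => //= fe; apply/eqP/esym/twin_eq.
    by rewrite (twinsP _ _ s1 s2) eeB fB eq_sym fe fz eqxx.
rewrite -(card_in_imset (f := pr)).
  apply: eq_card => p; apply/imsetP/imsetP=> -[].
    move=> z /xe[e [eeB <-]] ->; exists e => //; exact/esym/prE.
  move=> e eeB ->; exists (endpoint (~~ c) e); last exact: prE.
  by move: eeB; rewrite eB => /andP[].
move=> z z' /xe[e [eeB ez]] _ /setP/(_ e).
by rewrite !in_setI eeB !in_set ez eqxx => /esym/eqP.
Qed.

End OneBloom.
End Blooms.

(** * Maximal blooms and the butterfly count *)

Section Support.

Variables (U V : finType) (E : {set U * V}) (prio : U + V -> nat).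
Hypothesis prio_inj : injective prio.
Local Notation edge := (U * V)%type.
Local Notation vertex := (U + V)%type.
Local Notation bloom := ({set vertex} * {set vertex})%type.
Implicit Types (H S : {set edge}) (e f g : edge) (B : bloom) (x y z : vertex).

Lemma max_priority_bloomW B :
  max_priority_bloom E prio B -> priority_bloom E prio B.
Proof. by case/andP. Qed.

Lemma bloom_top B : priority_bloom E prio B ->
  exists2 y, y \in B.1 & {in bloom_vertices B, forall z, prio z <= prio y}.
Proof. by case/and4P=> _ _ _ /exists_inP[y yB /forall_inP]; exists y. Qed.

Lemma bloom_sub_sides c c' B B' :
  {in B.1, forall x, side x = c} -> {in B.2, forall z, side z = ~~ c} ->
  {in B'.1, forall x, side x = c'} -> {in B'.2, forall z, side z = ~~ c'} ->
  bloom_vertices B \subset bloom_vertices B' ->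
  if c == c' then (B.1 \subset B'.1) && (B.2 \subset B'.2)
  else (B.1 \subset B'.2) && (B.2 \subset B'.1).
Proof.
move=> s1 s2 s1' s2' /subsetP sub.
have in1 x : x \in B.1 -> x \in (if c == c' then B'.1 else B'.2).
  move=> xB; have : x \in bloom_vertices B' by apply: sub; rewrite inE xB.
  have sx := s1 x xB.
  rewrite inE => /orP[xB'|xB']; [have := s1' x xB'|have := s2' x xB'];
    by rewrite sx; move: xB'; case: (c); case: (c').
have in2 x : x \in B.2 -> x \in (if c == c' then B'.2 else B'.1).
  move=> xB; have : x \in bloom_vertices B' by apply: sub; rewrite inE xB orbT.
  have sx := s2 x xB.
  rewrite inE => /orP[xB'|xB']; [have := s1' x xB'|have := s2' x xB'];
    by rewrite sx; move: xB'; case: (c); case: (c').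
by case: ifP in1 in2 => _ in1 in2; apply/andP; split; apply/subsetP.
Qed.

(** The dominant pair is kept, and [Z] collects all its common neighbours not above the top vertex
    [y]; maximality is then checked against any bloom [B'] on more vertices. *)
Lemma max_priority_bloom_exists B0 : priority_bloom E prio B0 ->
  exists B, [/\ max_priority_bloom E prio B, B.1 = B0.1 & B0.2 \subset B.2].
Proof.
move=> bB0; have [y yB0 top] := bloom_top bB0.
have [c [s1 s2 _]] := priority_bloomP bB0.
case/and4P: (bB0) => /eqP c1 c2 /forall_inP adjB0 _.
pose D := B0.1.
pose Z := [set z | [forall x in D, adj E x z] && (prio z <= prio y)].
have B0Z : B0.2 \subset Z.
  apply/subsetP=> z zB; rewrite inE top ?inE ?zB ?orbT // andbT.
  by apply/forall_inP=> x xD; apply: (forall_inP (adjB0 x xD)).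
have sZ : {in Z, forall z, side z = ~~ c}.
  move=> z; rewrite inE => /andP[/forall_inP/(_ y yB0)/adj_side-> _].
  by rewrite s1.
have cZ : 2 <= #|Z| := leq_trans c2 (subset_leq_card B0Z).
have bDZ : priority_bloom E prio (D, Z).
  rewrite /priority_bloom /= c1 eqxx cZ /=; apply/andP; split.
    apply/forall_inP=> x xD; apply/forall_inP=> z.
    by rewrite inE => /andP[/forall_inP/(_ x xD)].
  apply/exists_inP; exists y => //; apply/forall_inP=> z.
  rewrite inE => /orP[zD|]; first by apply: top; rewrite inE zD.
  by rewrite inE => /andP[].
exists (D, Z); split=> //; rewrite /max_priority_bloom bDZ.
apply/forallP=> B'; apply/implyP=> bB'; apply/implyP=> sub.
have [c' [s1' s2' _]] := priority_bloomP bB'.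
have [y' yB' top'] := bloom_top bB'.
case/and4P: (bB') => /eqP c1' c2' /forall_inP adjB' _.
have := @bloom_sub_sides c c' (D, Z) B' s1 sZ s1' s2' sub.
have yy' : prio y <= prio y'.
  by apply: top'; apply: (subsetP sub); rewrite inE yB0.
case: ifP => cc /andP[/= sD sZ'].
  have {}sD : D = B'.1 by apply/eqP; rewrite eqEcard sD c1 c1'.
  suff ZE : Z = B'.2 by case: (B') sD ZE => /= ? ? <- <-.
  apply/eqP; rewrite eqEsubset sZ'; apply/subsetP=> z zB'; rewrite inE.
  apply/andP; split.
    by apply/forall_inP=> x; rewrite sD => xD; apply: (forall_inP (adjB' x xD)).
  apply: leq_trans (top' z _) _; first by rewrite inE zB' orbT.
  by apply: top; rewrite inE -/D sD yB'.
(* If [B'] is dominated from the other side, its top vertex lies in [Z], hence equals [y] by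
   injectivity of [prio], although the two are on opposite sides. *)
have ZB' : Z = B'.1 by apply/eqP; rewrite eqEcard sZ' c1'.
move: yB'; rewrite -ZB' => yZ; have := yZ; rewrite inE => /andP[_ y'y].
have yE : y = y' by apply: prio_inj; apply/eqP; rewrite eqn_leq yy'.
by have := sZ y' yZ; rewrite -yE s1 //; case: (c).
Qed.

(** The side of the butterfly containing its highest-priority vertex serves as dominant set of a
    2-bloom, which is then enlarged. *)
Lemma butterfly_bloom_exists (b : {set edge}) :
  is_butterfly b -> b \subset E ->
  exists2 B, max_priority_bloom E prio B & b \subset bloom_edges B.
Proof.
move=> bb bE.
have [X [Y [cX cY sX sY bXY]]] := is_butterflyP true b bb.
have adjXY x y : x \in X -> y \in Y -> adj E x y.
  move=> xX yY; have [e [ex ey]] := endpoint_surj (sX x xX) (sY y yY).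
  by rewrite -ex -ey adj_endpoint (subsetP bE) // bXY ex ey xX yY.
have adj_sym x y : adj E x y = adj E y x by case: x y => ? [].
have [x0 x0X] : exists x, x \in X by apply/card_gt0P; rewrite cX.
have x0XY : x0 \in X :|: Y by rewrite inE x0X.
have [y yXY top] : exists2 y, y \in X :|: Y &
    {in X :|: Y, forall z, prio z <= prio y}.
  by case: (@arg_maxnP _ x0 [in X :|: Y] prio x0XY) => y; exists y.
have [B0 bB0 bB0E] : exists2 B, priority_bloom E prio B &
    (B.1 = X /\ B.2 = Y) \/ (B.1 = Y /\ B.2 = X).
  move: yXY; rewrite inE => /orP[yX|yY].
    exists (X, Y); last by left.
    rewrite /priority_bloom /= cX cY eqxx /=; apply/andP; split.
      by apply/forall_inP=> x xX; apply/forall_inP=> z; apply: adjXY.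
    by apply/exists_inP; exists y => //; apply/forall_inP=> z; apply: top.
  exists (Y, X); last by right.
  rewrite /priority_bloom /= cX cY eqxx /=; apply/andP; split.
    by apply/forall_inP=> x xX; apply/forall_inP=> z zY; rewrite adj_sym adjXY.
  apply/exists_inP; exists y => //; apply/forall_inP=> z.
  by rewrite /bloom_vertices setUC; apply: top.
have [B [mB B1 /subsetP B2]] := max_priority_bloom_exists bB0.
exists B => //; apply/subsetP=> e; rewrite bXY /= => /andP[eX eY].
rewrite inE B1; case: bB0E => [] [E1 E2]; rewrite E1 E2 in B2 *.
  by rewrite eX B2.
by rewrite eY (B2 _ eX) orbT.
Qed.

(** By [butterfly_dominant], each of the two dominant sets is a side of [b]; they are the same side
    or opposite ones. *)
Lemma butterfly_bloom_uniq (b : {set edge}) B B' :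
  is_butterfly b -> max_priority_bloom E prio B -> max_priority_bloom E prio B' ->
  b \subset bloom_edges B -> b \subset bloom_edges B' -> B = B'.
Proof.
move=> bb mB mB' bB bB'.
have [pB pB'] := (max_priority_bloomW mB, max_priority_bloomW mB').
have [c [s1 s2 eB]] := priority_bloomP pB.
have [c' [s1' s2' eB']] := priority_bloomP pB'.
have [Y [cY sY] bE] := butterfly_dominant pB s1 s2 bb bB.
have [Y' [cY' sY'] bE'] := butterfly_dominant pB' s1' s2' bb bB'.
have [y yB top] := bloom_top pB; have [y' yB' top'] := bloom_top pB'.
case/and4P: (pB) => /eqP c1 c2 /forall_inP adjB _.
case/and4P: (pB') => /eqP c1' c2' /forall_inP adjB' _.
have [y1 y1Y] : exists x, x \in Y by apply/card_gt0P; rewrite cY.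
have [y1' y1Y'] : exists x, x \in Y' by apply/card_gt0P; rewrite cY'.
have XE x z : x \in B.1 -> z \in Y ->
    if c == c' then (x \in B'.1) && (z \in Y') else (x \in Y') && (z \in B'.1).
  move=> xB zY; have [e [ex ez]] := endpoint_surj (s1 x xB) (s2 z (subsetP sY z zY)).
  have : e \in b by rewrite bE ex ez xB.
  rewrite bE'; case: eqP => [<-|/eqP cc]; first by rewrite ex ez.
  have -> : c' = ~~ c by move: cc; case: (c); case: (c').
  by rewrite negbK ez ex andbC.
case: eqP XE => [cc XE|/eqP cc XE].
  have D : B.1 = B'.1.
    apply/eqP; rewrite eqEcard c1 c1' leqnn andbT; apply/subsetP=> x xB.
    by case/andP: (XE x y1 xB y1Y).
  (* Same dominant pair: merging the non-dominant sets gives a priority bloom above both, so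
     maximality identifies all three. *)
  pose C := (B.1, B.2 :|: B'.2).
  have yy' : y = y'.
    apply: prio_inj; apply/eqP; rewrite eqn_leq top' ?top //.
      by rewrite inE D yB'.
    by rewrite inE -D yB.
  have bC : priority_bloom E prio C.
    rewrite /priority_bloom /= c1 eqxx (leq_trans c2) ?subset_leq_card ?subsetUl //=.
    apply/andP; split.
      apply/forall_inP=> x xB; apply/forall_inP=> z; rewrite inE => /orP[] zB.
        exact: (forall_inP (adjB x xB)).
      by rewrite D in xB; exact: (forall_inP (adjB' x xB)).
    apply/exists_inP; exists y => //; apply/forall_inP=> z.
    rewrite !inE /= orbA => /orP[zB|zB]; first by apply: top; rewrite inE.
    by rewrite yy'; apply: top'; rewrite inE zB orbT.
  have maxE B1 : max_priority_bloom E prio B1 ->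
      bloom_vertices B1 \subset bloom_vertices C -> C = B1.
    by case/andP=> _ /forallP/(_ C); rewrite bC /= => /implyP h /h/eqP.
  apply: etrans (esym (maxE B mB _)) (maxE B' mB' _).
    by rewrite /bloom_vertices /= setUS // subsetUl.
  by rewrite /bloom_vertices /= -D setUS // subsetUr.
(* Opposite sides: each top vertex lies in the other bloom, so the two coincide, which contradicts
   their sides. *)
have yY' : y \in Y' by case/andP: (XE y y1 yB y1Y).
have y'Y : y' \in Y.
  have YB' : Y = B'.1.
    apply/eqP; rewrite eqEcard cY c1' leqnn andbT; apply/subsetP=> x xY.
    by case/andP: (XE y x yB xY).
  by rewrite YB'.
have yy' : y = y'.
  apply: prio_inj; apply/eqP; rewrite eqn_leq top' ?top //.
    by rewrite inE (subsetP sY) ?orbT.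
  by rewrite inE (subsetP sY') ?orbT.
by have := s1 y yB; rewrite yy' (s2 y') ?(subsetP sY) //; case: (c).
Qed.

Definition pair_of e B : {set edge} := [set e; twin e B].

(** The cardinality plays the role of the bloom number once only the edges of [H] remain. *)
Definition pairs H B : {set {set edge}} :=
  [set pair_of e B | e in bloom_edges B & (e \in H) && (twin e B \in H)].

(** The blooms remain those of [E]; a link disappears as soon as either twin leaves [H]. *)
Definition links_in H : {set edge * bloom} :=
  [set l | [&& max_priority_bloom E prio l.2, l.1 \in bloom_edges l.2, l.1 \in H
             & twin l.1 l.2 \in H]].

Lemma links_inP H e B : reflect
  [/\ max_priority_bloom E prio B, e \in bloom_edges B, e \in H & twin e B \in H]
  ((e, B) \in links_in H).
Proof. by rewrite [(e, B) \in _]in_set; apply: and4P. Qed.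

Lemma links_in_twin H e B : (e, B) \in links_in H -> (twin e B, B) \in links_in H.
Proof.
case/links_inP=> mB eB eH tH; have pB := max_priority_bloomW mB.
by apply/links_inP; split; rewrite ?(twinK pB) // (twin_edge pB).
Qed.

Lemma pairsP H B (p : {set edge}) : reflect
  (exists2 e, [/\ e \in bloom_edges B, e \in H & twin e B \in H] & p = pair_of e B)
  (p \in pairs H B).
Proof.
apply: (iffP imsetP) => -[e] eP ->; exists e => //.
  by move: eP; rewrite [e \in _]in_set => /and3P.
by rewrite [e \in _]in_set; apply/and3P.
Qed.

Lemma pairs_gt0 H e B : (e, B) \in links_in H -> 0 < #|pairs H B|.
Proof.
case/links_inP=> _ eB eH tH; apply/card_gt0P; exists (pair_of e B).
by apply/pairsP; exists e.
Qed.

(** A butterfly of [B] through [e] is the pair of [e] together with one other pair, and distinct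
    pairs are disjoint, so the choice of the other pair is a bijection. *)
Lemma card_butterflies_in_bloom H e B : H \subset E -> (e, B) \in links_in H ->
  #|[set b in butterflies_at H e | b \subset bloom_edges B]| = #|pairs H B| - 1.
Proof.
move=> HE /links_inP[mB eB eH tH]; have pB := max_priority_bloomW mB.
have pe : pair_of e B \in pairs H B by apply/pairsP; exists e.
have -> : #|pairs H B| - 1 = #|pairs H B :\ pair_of e B|.
  by rewrite (cardsD1 (pair_of e B)) pe addKn.
have disj f : f \in bloom_edges B -> pair_of f B != pair_of e B ->
    [disjoint pair_of f B & pair_of e B].
  move=> fB; apply: contraR => /pred0Pn[g /andP[gf ge]].
  by rewrite /pair_of -(twin_pair pB eB ge) (twin_pair pB fB gf).
rewrite -[RHS](card_in_imset (f := fun p => pair_of e B :|: p)); last first.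
  move=> p q /setD1P[pN /pairsP[f [fB _ _] pf]].
  case/setD1P=> qN /pairsP[g [gB _ _] qg] /setP eqpq.
  have dp := disj f fB; have dq := disj g gB.
  rewrite -pf in dp; rewrite -qg in dq; have {}dp := dp pN; have {}dq := dq qN.
  apply/setP=> h; have := eqpq h.
  rewrite (in_setU h (pair_of e B) p) (in_setU h (pair_of e B) q).
  case: (boolP (h \in pair_of e B)) => [he _|_ //].
  by rewrite (disjointFl dp he) (disjointFl dq he).
suff -> : [set b in butterflies_at H e | b \subset bloom_edges B] =
    [set pair_of e B :|: p | p in pairs H B :\ pair_of e B] by [].
apply/setP=> b; apply/idP/imsetP.
  rewrite in_set [b \in _]in_set [b \in butterflies H]in_set -!andbA.
  case/and4P=> bb bH eb bBe.
  have tb := butterfly_twin pB bb bBe eb.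
  have [f fb fN] : exists2 f, f \in b & f \notin pair_of e B.
    apply/subsetPn; apply/negP => /subset_leq_card.
    have [A /existsP[C /and3P[/eqP cA /eqP cC /eqP ->]]] := existsP bb.
    by rewrite cardsX cA cC cards2; case: (_ != _).
  have fB := subsetP bBe f fb.
  have tfb := butterfly_twin pB bb bBe fb.
  exists (pair_of f B).
    apply/setD1P; split.
      by apply: contra fN => /eqP <-; rewrite in_set2 eqxx.
    by apply/pairsP; exists f; split=> //; apply: (subsetP bH).
  have b2 := two_pairs_butterfly pB eB fB fN.
  have sub : pair_of e B :|: pair_of f B \subset b.
    by rewrite !subUset !sub1set eb tb fb tfb.
  apply/esym/eqP; rewrite eqEcard sub.
  have card4 (b' : {set edge}) : is_butterfly b' -> #|b'| = 4.
    case/existsP=> A /existsP[C /and3P[/eqP cA /eqP cC /eqP ->]].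
    by rewrite cardsX cA cC.
  by rewrite !card4.
case=> p /setD1P[pN /pairsP[f [fB fH tfH] pf]] ->.
have fN : f \notin pair_of e B.
  by apply: contra pN => fe; rewrite pf /pair_of (twin_pair pB eB fe).
rewrite pf in_set [_ \in butterflies_at _ _]in_set [_ \in butterflies _]in_set.
rewrite (two_pairs_butterfly pB) // !subUset !sub1set eH tH fH tfH eB fB.
by rewrite !(twin_edge pB) // in_setU in_set2 eqxx.
Qed.

(** Each butterfly is charged to its unique maximal bloom, and the order of summation is
    exchanged. *)
Lemma butterfly_countE H e : H \subset E -> e \in H ->
  butterfly_count H e = \sum_(B | (e, B) \in links_in H) (#|pairs H B| - 1).
Proof.
move=> HE eH; rewrite /butterfly_count -[LHS]sum1_card.
rewrite (eq_bigr (fun b : {set edge} => \sum_(B | (e, B) \in links_in H)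
                             (b \subset bloom_edges B : nat))); last first.
  move=> b; rewrite !inE => /andP[/andP[bb bH] eb].
  have [B mB bB] := butterfly_bloom_exists bb (subset_trans bH HE).
  rewrite (bigD1 B) /=; last first.
    apply/links_inP; split=> //; first exact: (subsetP bB).
    apply: (subsetP bH); apply: (butterfly_twin (max_priority_bloomW mB)) => //.
  rewrite bB big1 // => B' /andP[/links_inP[mB' _ _ _] BB'].
  apply/eqP; rewrite eqb0; apply: contra BB' => bB'; apply/eqP/esym.
  exact: butterfly_bloom_uniq bb mB mB' bB bB'.
rewrite exchange_big; apply: eq_bigr => B lB.
by rewrite -(card_butterflies_in_bloom HE lB) -sum1dep_card big_mkcondr.
Qed.

End Support.

(** * Removing edges *)

Section Peeling.

Variables (U V : finType) (E : {set U * V}) (prio : U + V -> nat).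
Hypothesis prio_inj : injective prio.
Local Notation edge := (U * V)%type.
Local Notation vertex := (U + V)%type.
Local Notation bloom := ({set vertex} * {set vertex})%type.
Local Notation links_in := (links_in E prio).
Variable ID : edge -> int.
Implicit Types (H S : {set edge}) (e f g : edge) (B : bloom).

Definition handles S e B : bool :=
  (twin e B \notin S) || (ID (twin e B) < ID e)%R.

Section Removal.

Variables H S : {set edge}.
Hypotheses (HE : H \subset E) (ID_inj : {in S &, injective ID}).

Definition handled : {set edge * bloom} :=
  [set l in links_in H | (l.1 \in S) && handles S l.1 l.2].

Lemma handledP e B : reflect
  [/\ (e, B) \in links_in H, e \in S & handles S e B] ((e, B) \in handled).
Proof. by rewrite [_ \in handled]in_set; apply: and3P. Qed.

(** If both twins are in [S], their IDs differ and exactly one passes the tie-break; so a pair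
    meeting [S] is handled by exactly one thread. *)
Lemma handled_one e B : (e, B) \in links_in H ->
  ((e, B) \in handled : nat) + ((twin e B, B) \in handled)
    = (e \in S) || (twin e B \in S) :> nat.
Proof.
move=> lB; have ltB := links_in_twin lB.
have [mB eB _ _] := links_inP _ _ _ _ _ lB; have pB := max_priority_bloomW mB.
rewrite [(e, B) \in handled]in_set [(twin e B, B) \in handled]in_set /= lB ltB /handles.
rewrite (twinK pB) //=.
case: (boolP (e \in S)) => eS; case: (boolP (twin e B \in S)) => tS //=.
have IDne : ID (twin e B) != ID e.
  by apply: contraNneq (twin_neq pB eB) => /ID_inj->.
by move: IDne; rewrite Order.TotalTheory.neq_lt; case: Order.TotalTheory.ltgtP.
Qed.

Definition handlers B : {set edge} := [set e | (e, B) \in handled].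

Lemma in_handlers e B : (e \in handlers B) = ((e, B) \in handled).
Proof. by rewrite [e \in _]in_set. Qed.

(** Sending a handling edge to its pair is a bijection onto the pairs destroyed by [S]. *)
Lemma card_pairsD B : max_priority_bloom E prio B ->
  #|pairs H B| = #|pairs (H :\: S) B| + #|handlers B|.
Proof.
move=> mB; have pB := max_priority_bloomW mB.
rewrite -(cardsID (pairs (H :\: S) B)) (setIidPr _); last first.
  apply/subsetP=> p /pairsP[e [eB /setDP[eH _] /setDP[tH _]] ->].
  by apply/pairsP; exists e.
congr (_ + _); rewrite -[RHS](card_in_imset (f := fun e => pair_of e B)); last first.
  move=> e f; rewrite !in_handlers => ew fw ef.
  have [lB _ _] := handledP _ _ ew; have [_ eB _ _] := links_inP _ _ _ _ _ lB.
  have : f \in pair_of e B by rewrite ef in_set2 eqxx.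
  rewrite in_set2 => /orP[/eqP //|/eqP fe]; have := handled_one lB.
  by rewrite ew -fe fw; case: (_ || _).
suff -> : pairs H B :\: pairs (H :\: S) B =
    [set pair_of e B | e in handlers B] by [].
apply/setP=> p; apply/setDP/imsetP.
  case=> /pairsP[e [eB eH tH] ->] pN.
  have lB : (e, B) \in links_in H by apply/links_inP.
  have := handled_one lB.
  have -> : (e \in S) || (twin e B \in S).
    apply: contraR pN; rewrite negb_or => /andP[eS tS]; apply/pairsP; exists e => //.
    by split=> //; apply/setDP.
  case: (boolP ((e, B) \in handled)) => [ew _|_ /= tw].
    by exists e; rewrite // in_handlers.
  exists (twin e B); last by rewrite /pair_of (twinK pB) // setUC.
  by rewrite in_handlers; move: tw; case: (_ \in _).
case=> e; rewrite in_handlers => /handledP[/links_inP[_ eB eH tH] eS _] ->.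
split; first by apply/pairsP; exists e.
apply/negP=> /pairsP[f [fB /setDP[_ fS] /setDP[_ tS]] ef].
have : e \in pair_of f B by rewrite -ef in_set2 eqxx.
by rewrite in_set2 => /orP[] /eqP ee; rewrite -ee eS in fS tS.
Qed.

(* What one thread handling the pair of e in B subtracts from f. *)
Definition pair_loss e B f : nat :=
  (twin e B == f) * (#|pairs H B| - 1)
  + (((f, B) \in links_in H) && (f \notin S) && (twin f B \notin S)).

(** Bloom by bloom: if the twin of [f] is in [S], the whole contribution of the bloom is lost and
    charged to the twin; otherwise each handled pair costs [f] one butterfly. *)
Lemma butterfly_countD f : f \in H :\: S ->
  butterfly_count H f = butterfly_count (H :\: S) f
    + \sum_(l in handled) pair_loss l.1 l.2 f.
Proof.
move=> /setDP[fH fS].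
have HSE : H :\: S \subset E by apply: subset_trans (subsetDl _ _) HE.
rewrite !(@butterfly_countE _ _ E _ prio_inj) // ?in_setD ?fS //.
rewrite big_mkcond [X in _ = X + _]big_mkcond /=.
have -> : \sum_(l in handled) pair_loss l.1 l.2 f =
    \sum_B \sum_(e | (e, B) \in handled) pair_loss e B f.
  rewrite (exchange_big_dep predT) //= pair_big_dep /=.
  by apply: eq_bigl => -[].
rewrite -big_split /=; apply: eq_bigr => B _.
have lD : ((f, B) \in links_in (H :\: S)) =
    ((f, B) \in links_in H) && (twin f B \notin S).
  apply/links_inP/andP=> [[mB fB /setDP[_ _] /setDP[tH tS]]|].
    by split=> //; apply/links_inP.
  by case=> /links_inP[mB fB _ tH] tS; split=> //; apply/setDP.
rewrite lD /pair_loss fS andbT.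
case: (boolP ((f, B) \in links_in H)) => lB /=; last first.
  rewrite big1 // => e /handledP[/links_in_twin leB _ _].
  by case: eqP => // te; rewrite -te leB in lB.
have [mB fB _ tH] := links_inP _ _ _ _ _ lB; have pB := max_priority_bloomW mB.
case: (boolP (twin f B \in S)) => tS /=.
  have tw : (twin f B, B) \in handled.
    apply/handledP; split=> //; first exact: links_in_twin.
    by rewrite /handles (twinK pB) // fS.
  rewrite (bigD1 (twin f B)) //= (twinK pB) // eqxx mul1n addn0 big1 ?addn0 //.
  move=> e /andP[/handledP[/links_inP[_ eB _ _] _ _] ef].
  by case: eqP => //= te; rewrite -te (twinK pB) // eqxx in ef.
rewrite (eq_bigr (fun=> 1)) => [|e /handledP[/links_inP[_ eB _ _] eS _]]; last first.
  case: eqP => [te|_]; last by rewrite mul0n.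
  by rewrite -te (twinK pB) // eS in tS.
(* The surviving pair of [f] makes the truncated subtraction of 1 exact. *)
have gt0 : 0 < #|pairs (H :\: S) B|.
  by apply: (@pairs_gt0 _ _ E prio _ f); rewrite lD lB.
by rewrite sum1dep_card -/(handlers B) addnC addnBA // addnC -card_pairsD.
Qed.

Lemma links_inD e B : ((e, B) \in links_in (H :\: S)) =
  [&& (e, B) \in links_in H, (e, B) \notin handled & (twin e B, B) \notin handled].
Proof.
apply/links_inP/and3P=> [[mB eB /setDP[eH eS] /setDP[tH tS]]|[lB nw ntw]].
  split; first exact/links_inP.
    by apply/handledP=> -[_]; rewrite (negPf eS).
  by apply/handledP=> -[_]; rewrite (negPf tS).
have := handled_one lB; rewrite (negPf nw) (negPf ntw).
have [mB eB eH tH] := links_inP _ _ _ _ _ lB.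
case: (boolP (e \in S)) => // eS; case: (boolP (twin e B \in S)) => // tS _.
by split=> //; apply/setDP.
Qed.

End Removal.
End Peeling.

(** * Parallel updates *)

Lemma sum_pred_eq (T : finType) (A : pred T) x :
  \sum_(y | A y) (y == x) = A x :> nat.
Proof.
case: (boolP (A x)) => Ax.
  by rewrite (bigD1 x) //= eqxx big1 // => y /andP[_ /negPf->].
by rewrite big1 // => y Ay; case: eqP => // yx; rewrite -yx Ay in Ax.
Qed.

Section Interleavings.

Variables (U V : finType) (ID : U * V -> int).
Local Notation edge := (U * V)%type.
Local Notation vertex := (U + V)%type.
Local Notation bloom := ({set vertex} * {set vertex})%type.
Local Notation instr := (instr U V).
Variables (S : {set edge}) (theta : nat) (num : bloom -> nat).
Implicit Types (e f g : edge) (B : bloom) (c : instr) (pool : edge -> seq instr).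

(** This balance of one step, additive to avoid truncated subtraction, serves both the termination
    measure and the conserved quantities below. *)
Lemma sum_pool_upd (F : edge -> instr -> nat) pool e c cs new :
  pool e = c :: cs ->
  \sum_g \sum_(d <- upd pool e (new ++ cs) g) F g d + F e c =
  \sum_g \sum_(d <- pool g) F g d + \sum_(d <- new) F e d.
Proof.
move=> pe; rewrite (bigD1 e) // [in RHS](bigD1 e) //= pe /upd eqxx.
rewrite big_cat big_cons /=.
rewrite (eq_bigr (fun g => \sum_(d <- pool g) F g d)); last first.
  by move=> g /negPf ->.
by lia.
Qed.

(** A termination measure: each instruction outweighs its expansion. A visit yields four unit
    instructions and a scan, of total weight [#|{: edge}| + 5]. *)
Definition instr_weight c : nat :=
  match c with
  | Start => (#|{: bloom}| * (#|{: edge}| + 6)).+1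
  | Visit _ => #|{: edge}| + 6
  | Scan _ => #|{: edge}|.+1
  | _ => 1
  end.

Lemma exec_progress e c (s : shared U V) : exists new s1,
  exec ID S theta num e c s new s1 /\
  \sum_(d <- new) instr_weight d < instr_weight c.
Proof.
have sumC (T : finType) (A : {set T}) (F : T -> instr) k :
    (forall x, instr_weight (F x) = k) ->
    \sum_(d <- map F (enum A)) instr_weight d <= #|T| * k.
  move=> Fk; rewrite big_map (eq_bigr (fun=> k)) // big_const_seq count_predT.
  by rewrite iter_addn_0 -cardE mulnC leq_mul2r max_card orbT.
case: c => [|B|B|f B|B|B|f].
- exists (map (@Visit U V) (enum (blooms_of (sh_links s) e))), s; split.
    exact: ExecStart.
  by rewrite ltnS; apply: sumC.
- have := ExecVisit ID S theta num e s B; case: ifP => _ ex; eexists; exists s;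
    by (split; first exact: ex); rewrite ?(big_cons, big_nil) /=; lia.
- by eexists; eexists; split; [exact: ExecDecrTwin|rewrite big_nil].
- by eexists; eexists; split; [exact: ExecDelete|rewrite big_nil].
- by eexists; eexists; split; [exact: ExecIncrCount|rewrite big_nil].
- exists (map (@Decr_one U V)
    (enum [set f in edges_of (sh_links s) B | twin f B \notin S])), s; split.
    exact: ExecScan.
  by rewrite ltnS -[X in _ <= X]muln1; apply: sumC.
- by eexists; eexists; split; [exact: ExecDecrOne|rewrite big_nil].
Qed.

Lemma interleave_exists pool (s : shared U V) :
  exists s', interleave ID S theta num pool s s'.
Proof.
have [n] := ubnP (\sum_g \sum_(d <- pool g) instr_weight d).
elim: n pool s => // n IHn pool s lt_n.
case: (pickP (fun e => ~~ nilp (pool e))) => [e|none]; last first.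
  by exists s; apply: InterleaveDone => e; apply/nilP/negbFE/none.
case pe : (pool e) => [//|c cs] _.
have [new [s1 [ex lt]]] := exec_progress e c s.
have [|s' is'] := IHn (upd pool e (new ++ cs)) s1.
  by have := sum_pool_upd (fun=> instr_weight) new pe; lia.
by exists s'; apply: InterleaveStep pe ex is'.
Qed.

End Interleavings.

(* The net effect of a parallel update does not depend on the interleaving:
   each pending instruction is expanded into the elementary updates of the
   shared state that it will eventually cause, and the updates still pending
   together with those already done are the same at all times. *)
Section ParallelUpdate.

Variables (U V : finType) (E : {set U * V}) (prio : U + V -> nat).
Local Notation edge := (U * V)%type.
Local Notation vertex := (U + V)%type.
Local Notation bloom := ({set vertex} * {set vertex})%type.
Local Notation instr := (instr U V).
Local Notation links_in := (links_in E prio).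
Variables (ID : edge -> int) (H S : {set edge}).
Hypothesis (ID_inj : {in S &, injective ID}).
Variables (theta : nat) (supp0 : edge -> nat) (num : bloom -> nat).
Hypothesis numE :
  forall B, max_priority_bloom E prio B -> num B = #|pairs H B|.
Implicit Types (e f g : edge) (B : bloom) (c : instr) (pool : edge -> seq instr).

Local Notation handled := (handled E prio ID H S).

Inductive atom :=
  | Atom_decr of edge & nat
  | Atom_delete of edge * bloom
  | Atom_incr of bloom.

Implicit Type w : atom -> nat.

(** This uses the initial links and skips edges of [S]. An actual scan reads the current links and
    may decrement edges of [S], a difference invisible to weights satisfying [ignores_S]. *)
Definition scan_atoms B : seq atom :=
  [seq Atom_decr f 1 |
     f <- enum [set f in edges_of (links_in H) B | (f \notin S) && (twin f B \notin S)]].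

Definition visit_atoms e B : seq atom :=
  if handles ID S e B
  then [:: Atom_decr (twin e B) (num B - 1); Atom_delete (e, B);
           Atom_delete (twin e B, B); Atom_incr B] ++ scan_atoms B
  else [::].

Definition atoms e c : seq atom :=
  match c with
  | Start => flatten [seq visit_atoms e B | B <- enum (blooms_of (links_in H) e)]
  | Visit B => visit_atoms e B
  | Decr_twin B => [:: Atom_decr (twin e B) (num B - 1)]
  | Delete f B => [:: Atom_delete (f, B)]
  | Incr_count B => [:: Atom_incr B]
  | Scan B => scan_atoms B
  | Decr_one f => [:: Atom_decr f 1]
  end.

Definition instr_cost w e c : nat := \sum_(a <- atoms e c) w a.

Definition pending w pool : nat := \sum_e \sum_(c <- pool e) instr_cost w e c.

Definition decr_cost f (a : atom) : nat :=
  if a is Atom_decr g k then (g == f) * k else 0.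

Definition delete_cost l (a : atom) : nat :=
  if a is Atom_delete l' then l' == l else false.

Definition incr_cost B (a : atom) : nat :=
  if a is Atom_incr B' then B' == B else false.

(* The supports of the edges of S no longer matter, and indeed their final
   values do depend on the interleaving. *)
Definition ignores_S w : Prop := forall f k, f \in S -> w (Atom_decr f k) = 0.

Lemma ignores_S_decr f : f \notin S -> ignores_S (decr_cost f).
Proof.
by move=> fS g k gS /=; case: eqP => // gf; rewrite -gf gS in fS.
Qed.

Definition initial_pool e : seq instr := if e \in S then [:: Start U V] else [::].

Definition total w : nat := pending w initial_pool.

Lemma instr_cost_Start w e :
  instr_cost w e (Start U V) =
    \sum_(B | (e, B) \in links_in H) \sum_(a <- visit_atoms e B) w a.
Proof.
rewrite /instr_cost /= big_flatten big_map big_enum_cond /=.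
by apply: eq_bigl => B; rewrite in_set andbT.
Qed.

Lemma totalE w :
  total w = \sum_(l in handled) \sum_(a <- visit_atoms l.1 l.2) w a.
Proof.
rewrite /total /pending.
have -> : \sum_(l in handled) \sum_(a <- visit_atoms l.1 l.2) w a =
    \sum_e \sum_(B | (e, B) \in handled) \sum_(a <- visit_atoms e B) w a.
  by rewrite pair_big_dep /=; apply: eq_bigl => -[].
apply: eq_bigr => e _; rewrite /initial_pool; case: ifP => eS; last first.
  by rewrite big_nil big_pred0 // => B; rewrite [_ \in handled]in_set /= eS andbF.
rewrite big_seq1 instr_cost_Start big_mkcond [RHS]big_mkcond /=.
apply: eq_bigr => B _; rewrite [_ \in handled]in_set /= eS /visit_atoms.
by case: (_ \in _); case: (handles _ _ _ _); rewrite ?big_nil.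
Qed.

Lemma scan_atoms_cost w B :
  \sum_(a <- scan_atoms B) w a =
  \sum_(f | ((f, B) \in links_in H) && (f \notin S) && (twin f B \notin S))
     w (Atom_decr f 1).
Proof.
rewrite big_map big_enum_cond /=; apply: eq_bigl => f.
by rewrite in_set andbT [f \in edges_of _ _]in_set andbA.
Qed.

Lemma scan_atoms0 w B : (forall f k, w (Atom_decr f k) = 0) ->
  \sum_(a <- scan_atoms B) w a = 0.
Proof. by move=> w0; rewrite big_map big1. Qed.

(** A link is deleted only by the unique handler of its pair, hence at most once. *)
Lemma total_delete e B : (e, B) \in links_in H ->
  total (delete_cost (e, B)) = (e \in S) || (twin e B \in S).
Proof.
move=> lB; have [mB eB _ _] := links_inP _ _ _ _ _ lB.
have pB := max_priority_bloomW mB.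
rewrite totalE -(handled_one ID_inj lB).
have h l : l \in handled ->
    \sum_(a <- visit_atoms l.1 l.2) delete_cost (e, B) a =
    (l == (e, B)) + (l == (twin e B, B)).
  case: l => f B' /handledP[/links_inP[mB' fB' _ _] _ hf].
  rewrite /visit_atoms hf big_cat scan_atoms0 // !big_cons big_nil /= !addn0 add0n.
  congr (_ + _); rewrite !xpair_eqE; case: (B' =P B) => [BB|]; rewrite ?andbF ?andbT //.
  rewrite BB in fB' *; congr nat_of_bool.
  by apply/eqP/eqP=> [<-|->]; rewrite (twinK pB).
by rewrite (eq_bigr _ h) big_split /= !sum_pred_eq.
Qed.

(** Decrements truncated at [theta] commute, so only their pending sum matters in [inv_supp]. A link
    is present iff none of its planned deletions has run, that is, iff all are still pending. *)
Record invariant pool (s : shared U V) : Prop := Invariant {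
  inv_supp : forall f, f \notin S ->
    maxn theta (sh_supp s f - pending (decr_cost f) pool) =
    maxn theta (supp0 f - total (decr_cost f));
  inv_supp_ge : forall f, theta <= supp0 f -> theta <= sh_supp s f;
  inv_count : forall B,
    sh_count s B + pending (incr_cost B) pool = total (incr_cost B);
  inv_delete : forall l, pending (delete_cost l) pool <= total (delete_cost l);
  inv_links : forall l, (l \in sh_links s) =
    (l \in links_in H) && (pending (delete_cost l) pool == total (delete_cost l))
}.

Lemma invariant_same_pending pool pool' s :
  (forall w, ignores_S w -> pending w pool' = pending w pool) ->
  invariant pool s -> invariant pool' s.
Proof.
move=> same [i1 i2 i3 i4 i5]; split=> //.
- by move=> f fS; rewrite same ?i1 //; apply: ignores_S_decr.
- by move=> B; rewrite same.
- by move=> l; rewrite same.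
- by move=> l; rewrite same.
Qed.

Lemma pending_upd w pool e c cs new : pool e = c :: cs ->
  pending w (upd pool e (new ++ cs)) + instr_cost w e c =
  pending w pool + \sum_(d <- new) instr_cost w e d.
Proof. exact: sum_pool_upd. Qed.

(** A link that [e] must handle is still there when [e] starts, since its only deletion is pending
    in [e] itself; for the links that [e] does not handle the visit is empty. *)
Lemma start_keeps_pending w pool s e cs bs : ignores_S w ->
  invariant pool s -> pool e = Start U V :: cs ->
  perm_eq bs (enum (blooms_of (sh_links s) e)) ->
  \sum_(d <- map (@Visit U V) bs) instr_cost w e d = instr_cost w e (Start U V).
Proof.
move=> wS [_ _ _ i4 i5] pe /(perm_big _) pbs.
rewrite instr_cost_Start big_map pbs /= big_enum_cond /=.
rewrite big_mkcond [RHS]big_mkcond; apply: eq_bigr => B _ /=.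
rewrite in_set andbT i5; case: (boolP ((e, B) \in links_in H)) => //= lB.
case: eqP => // ne; rewrite /instr_cost /= /visit_atoms.
case: ifP => hB; rewrite ?big_nil //; case: ne; apply/eqP.
rewrite eqn_leq i4 total_delete //=; apply: leq_trans (leq_b1 _) _.
rewrite /pending (bigD1 e) //= pe big_cons instr_cost_Start (bigD1 B) //=.
rewrite /visit_atoms hB big_cat /= !big_cons /= eqxx; lia.
Qed.

(** The scan sees the same edges at any time: links of pairs disjoint from [S] are never deleted,
    and the remaining ones are filtered out or ignored by [w]. *)
Lemma scan_keeps_pending w pool s e B fs : ignores_S w ->
  invariant pool s ->
  perm_eq fs (enum [set f in edges_of (sh_links s) B | twin f B \notin S]) ->
  \sum_(d <- map (@Decr_one U V) fs) instr_cost w e d =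
  instr_cost w e (Scan B).
Proof.
move=> wS [_ _ _ i4 i5] /(perm_big _) pfs.
rewrite /instr_cost /= scan_atoms_cost big_map pfs /= big_enum_cond /=.
rewrite big_mkcond [RHS]big_mkcond; apply: eq_bigr => f _.
rewrite in_set andbT [f \in edges_of _ _]in_set i5 big_seq1.
case: (boolP ((f, B) \in links_in H)) => //= lB.
case: (boolP (f \in S)) => [fS|fS] /=; first by rewrite wS // if_same.
case: (boolP (twin f B \in S)) => [tS|tS] /=; first by rewrite andbF.
have := i4 (f, B); rewrite total_delete // (negPf fS) (negPf tS) leqn0.
by move=> ->.
Qed.

Definition apply_atom (a : atom) (s : shared U V) : shared U V :=
  match a with
  | Atom_decr f k =>
      Shared (decr (sh_supp s) theta f k) (sh_links s) (sh_count s)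
  | Atom_delete l => Shared (sh_supp s) (sh_links s :\ l) (sh_count s)
  | Atom_incr B =>
      Shared (sh_supp s) (sh_links s) (upd (sh_count s) B (sh_count s B).+1)
  end.

Lemma invariant_atom pool pool' s a :
  (forall w, pending w pool' + w a = pending w pool) ->
  invariant pool s -> invariant pool' (apply_atom a s).
Proof.
move=> pend [i1 i2 i3 i4 i5]; split.
- move=> f fS; rewrite -i1 // -pend.
  case: a {pend} => [g k|l|B] /=; rewrite ?addn0 //.
  rewrite /decr /upd (eq_sym g); case: eqP => [->|_] /=; lia.
- move=> f /i2; case: a {pend} => //= g k.
  by rewrite /decr /upd; case: eqP => [<-|//]; rewrite leq_maxl.
- move=> B; rewrite -i3 -(pend (incr_cost B)).
  case: a {pend} => [g k|l|B'] /=; rewrite ?addn0 //.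
  by rewrite /upd (eq_sym B'); case: eqP => [->|_] /=; lia.
- by move=> l; have := i4 l; have := pend (delete_cost l); lia.
- move=> l; have := i4 l; have := i5 l; have := pend (delete_cost l).
  case: a {pend} => [g k|l'|B'] /=; rewrite ?addn0; [by move=> ->| |by move=> ->].
  rewrite in_setD1 (eq_sym l'); case: eqP => [->|_] /=; last by rewrite addn0 => ->.
  by move=> <- _ le; rewrite [_ == _](_ : _ = false) ?andbF //; lia.
Qed.

(** An instruction either unfolds without changing pending costs, or performs a single atom. *)
Lemma exec_invariant pool s e c cs new s1 :
  pool e = c :: cs -> exec ID S theta num e c s new s1 ->
  invariant pool s -> invariant (upd pool e (new ++ cs)) s1.
Proof.
move=> pe ex inv.
have same : (forall w, ignores_S w ->
      \sum_(d <- new) instr_cost w e d = instr_cost w e c) ->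
    invariant (upd pool e (new ++ cs)) s.
  move=> costE; apply: invariant_same_pending (inv) => w wS.
  by have := pending_upd w new pe; rewrite costE //; lia.
have atomic a : atoms e c = [:: a] -> new = [::] -> s1 = apply_atom a s ->
    invariant (upd pool e (new ++ cs)) s1.
  move=> ca new0 ->; apply: invariant_atom (inv) => w.
  by have := pending_upd w new pe; rewrite /instr_cost ca new0 big_nil big_seq1; lia.
case: ex pe inv same atomic => {c new s s1}.
- move=> s bs pbs pe inv + _; apply=> w wS.
  exact: start_keeps_pending wS inv pe pbs.
- move=> s B pe inv + _; apply=> w wS; rewrite /instr_cost /= /visit_atoms /handles.
  case: ifP => _; last by rewrite !big_nil.
  by rewrite !big_cons !big_nil /= !addn0.
- by move=> s B _ _ _; apply.
- by move=> s f B _ _ _; apply.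
- by move=> s B _ _ _; apply.
- move=> s B fs pfs pe inv + _; apply=> w wS.
  exact: scan_keeps_pending wS inv pfs.
- by move=> s f _ _ _; apply.
Qed.

Lemma interleave_invariant pool s s' :
  interleave ID S theta num pool s s' -> invariant pool s ->
  exists2 pool', (forall e, pool' e = [::]) & invariant pool' s'.
Proof.
elim=> {pool s s'} [pool s done inv|pool s e c cs new s1 s2 pe ex _ IH inv].
  by exists pool.
by apply: IH; apply: exec_invariant pe ex inv.
Qed.

Lemma total_incr B : total (incr_cost B) = #|handlers E prio ID H S B|.
Proof.
rewrite totalE.
have h l : l \in handled ->
    \sum_(a <- visit_atoms l.1 l.2) incr_cost B a = (l.2 == B).
  case: l => f B' /handledP[_ _ hf].
  by rewrite /visit_atoms hf big_cat scan_atoms0 // !big_cons big_nil /= !addn0.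
rewrite (eq_bigr _ h) -big_mkcondr /= -sum1_card.
rewrite (reindex_onto (fun e => (e, B)) (fun l => l.1)) /=; last first.
  by case=> e B' /andP[_ /eqP /= ->].
by apply: eq_bigl => e; rewrite in_handlers !eqxx !andbT.
Qed.

(** At the end nothing is pending, so the invariant expresses the final state through the totals
    alone. *)
Lemma parallel_updateP I supp I' :
  parallel_update ID S theta supp0 I supp I' ->
  links I = links_in H -> bloom_number I = num ->
  [/\ links I' = links_in (H :\: S),
      forall B, max_priority_bloom E prio B ->
        bloom_number I' B = #|pairs (H :\: S) B|
    & forall f, f \in H :\: S -> theta <= supp0 f ->
        supp f = maxn theta
          (supp0 f - \sum_(l in handled) pair_loss E prio H S l.1 l.2 f)].
Proof.
case=> s + LI nI; rewrite LI nI => /interleave_invariant[].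
  split=> //=; first by move=> l; rewrite eqxx andbT.
move=> pool' pool0 [i1 i2 i3 _ i5].
have p0 w : pending w pool' = 0.
  by rewrite /pending big1 // => e _; rewrite pool0 big_nil.
split=> /=.
- apply/setP=> -[e B]; rewrite i5 p0 (links_inD _ _ _ ID_inj).
  case: (boolP ((e, B) \in links_in H)) => //= lB.
  rewrite total_delete // -(handled_one ID_inj lB).
  by case: (_ \in handled); case: (_ \in handled).
- move=> B mB; rewrite numE // (card_pairsD _ ID_inj mB) //.
  by rewrite -total_incr -i3 p0 addn0 addnK.
- move=> f fHS le; have /setDP[fH fS] := fHS.
  have := i1 f fS; rewrite p0 subn0 (maxn_idPr (i2 f le)) => ->.
  congr (maxn _ (_ - _)); rewrite totalE; apply: eq_bigr => -[e B].
  case/handledP=> /links_inP[mB _ _ _] _ he; rewrite /visit_atoms he big_cat /=.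
  rewrite !big_cons big_nil /= !addn0 scan_atoms_cost /pair_loss.
  rewrite numE //; congr (_ + _).
  rewrite -[RHS](sum_pred_eq (fun g =>
    ((g, B) \in links_in H) && (g \notin S) && (twin g B \notin S)) f).
  by apply: eq_bigr => g _ /=; rewrite muln1.
Qed.

End ParallelUpdate.

(** * Coarse-grained decomposition *)

Section Coarse.

Variables (U V : finType) (E : {set U * V}) (prio : U + V -> nat).
Hypothesis prio_inj : injective prio.
Local Notation edge := (U * V)%type.
Local Notation vertex := (U + V)%type.
Local Notation bloom := ({set vertex} * {set vertex})%type.
Local Notation links_in := (links_in E prio).
Local Notation count := (@butterfly_count U V).
Variable ID : edge -> int.
Hypothesis ID_inj : {in E &, injective ID}.
Implicit Types (H S K : {set edge}) (e f g : edge) (B : bloom) (s : cd_state U V).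

Definition indexes H (I : be_index U V) : Prop :=
  links I = links_in H /\
  forall B, max_priority_bloom E prio B -> bloom_number I B = #|pairs H B|.

Lemma BE_Index_indexes : indexes E (BE_Index E prio).
Proof.
split=> [|B mB] /=.
  apply/setP=> -[e B]; rewrite [LHS]in_set.
  apply/andP/links_inP=> /= [[mB eB]|[mB eB _ _]] //.
  have pB := max_priority_bloomW mB; have /subsetP sE := bloom_edges_sub pB.
  by split=> //; apply: sE => //; apply: (twin_edge pB).
have pB := max_priority_bloomW mB; have /subsetP sE := bloom_edges_sub pB.
rewrite (card_bloom_pairs pB); suff -> : pairs E B =
  [set [set e; twin e B] | e in bloom_edges B] by [].
apply/setP=> p; apply/pairsP/imsetP=> -[e].
  by case=> eB _ _ ->; exists e.
by move=> eB ->; exists e => //; split=> //; apply: sE => //; apply: (twin_edge pB).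
Qed.

(* With [cd_part] the map p, this is E_j \cup ... \cup E_P together with the
   edges not yet in any partition. *)
Definition from_stage (part : edge -> nat) j : {set edge} :=
  [set e in E | (part e == 0) || (j <= part e)].

(** Together [inv_core] and [inv_top] say that [from_stage] at [j] is the largest theta(j)-core;
    [inv_init] records the supports that FD starts from. *)
Record stage_invariant s : Prop := StageInvariant {
  inv_i : 0 < cd_i s;
  inv_rem : forall e, (e \in cd_rem s) = (e \in E) && (cd_part s e == 0);
  inv_part : forall e, cd_part s e <= cd_i s;
  inv_index : indexes (cd_rem s) (cd_index s);
  inv_cd_supp : {in cd_rem s, forall e,
    cd_supp s e = maxn (cd_theta s (cd_i s)) (count (cd_rem s) e)};
  inv_core : forall j, 1 <= j <= cd_i s ->
    is_core E (cd_theta s j) (from_stage (cd_part s) j);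
  inv_top : forall j, 1 <= j <= cd_i s -> forall k K,
    cd_theta s j <= k -> is_core E k K -> K \subset from_stage (cd_part s) j;
  inv_theta : forall j, 1 <= j < cd_i s -> cd_theta s j < cd_theta s j.+1;
  inv_init : forall e, e \in E -> 0 < cd_part s e ->
    cd_init s e = count (from_stage (cd_part s) (cd_part s e)) e
}.

Record loop_invariant s : Prop := LoopInvariant {
  loop_stage :> stage_invariant s;
  loop_part : forall e, cd_part s e < cd_i s
}.

(** This holds inside a stage: [peel_top] prepares [inv_top] for the next index, whose core property
    is only reached when no edge is active. *)
Record peel_invariant s : Prop := PeelInvariant {
  peel_stage :> stage_invariant s;
  peel_theta : cd_theta s (cd_i s) < cd_theta s (cd_i s).+1;
  peel_init : {in cd_rem s, forall e,
    cd_init s e = count (from_stage (cd_part s) (cd_i s)) e};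
  peel_top : forall k K,
    cd_theta s (cd_i s).+1 <= k -> is_core E k K -> K \subset cd_rem s
}.

Lemma from_stageE s j : stage_invariant s -> (forall e, cd_part s e < j) ->
  from_stage (cd_part s) j = cd_rem s.
Proof.
move=> inv lt; apply/setP=> e; rewrite in_set (inv_rem inv).
by rewrite leqNgt lt orbF.
Qed.

Lemma rem_sub s : stage_invariant s -> cd_rem s \subset E.
Proof. by move=> inv; apply/subsetP=> e; rewrite (inv_rem inv) => /andP[]. Qed.

Lemma cd_start_invariant : loop_invariant (cd_start E prio).
Proof.
have fromE j : from_stage (fun=> 0) j = E by apply/setP=> e; rewrite in_set andbT.
split=> //; split=> //=.
- by move=> e; rewrite andbT.
- exact: BE_Index_indexes.
- by move=> e _; rewrite max0n.
- by move=> j _; rewrite fromE.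
- by move=> j _ k K _ [KE _]; rewrite fromE.
- by case=> [|[]].
Qed.

Lemma open_stage_invariant s tgt ub : loop_invariant s ->
  is_theta_ub s tgt ub -> peel_invariant (open_stage s ub).
Proof.
move=> inv [[e0 e0R se0] _ _].
have fromE := from_stageE inv (loop_part inv).
have lei : cd_i s == (cd_i s).+1 = false by apply: ltn_eqF.
have lej j : j <= cd_i s -> j == (cd_i s).+1 = false by move=> ?; apply: ltn_eqF.
(* The bound [ub] is attained by a remaining edge, whose support is at least theta(i); hence the
   thresholds strictly increase. *)
have lt : cd_theta s (cd_i s) <= ub by rewrite -se0 (inv_cd_supp inv) // leq_maxl.
have [i1 i2 i3 i4 i5 i6 i7 i8 i9] := loop_stage inv.
split=> /=; last 3 first.
- by rewrite /upd eqxx lei ltnS.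
(* The remaining edges form a theta(i)-core, so the truncation in the support is void and [cd_init]
   is an exact count. *)
- move=> e eR; rewrite eR fromE (inv_cd_supp inv) //; apply/maxn_idPr.
  have [_] : is_core E (cd_theta s (cd_i s)) (cd_rem s).
    by rewrite -fromE; apply: i6; rewrite i1 leqnn.
  exact.
- move=> k K; rewrite /upd eqxx => ltk; rewrite -fromE; apply: i7.
    by rewrite i1 leqnn.
  exact: leq_trans lt (ltnW ltk).
split=> //=.
- by move=> e eR; rewrite /upd lei i5.
- by move=> j /andP[j1 ji]; rewrite /upd lej //; apply: i6; rewrite j1 ji.
- by move=> j /andP[j1 ji] k K; rewrite /upd lej //; apply: i7; rewrite j1 ji.
- move=> j /andP[j1 ji]; rewrite /upd !lej //; last exact: ltnW.
  by apply: i8; rewrite j1 ji.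
- by move=> e eE pe; rewrite i2 eE (gtn_eqF pe) i9.
Qed.

Lemma peel_iter_invariant s supp I : peel_invariant s ->
  parallel_update ID (active s) (cd_theta s (cd_i s)) (cd_supp s) (cd_index s)
    supp I ->
  peel_invariant (CDState supp I (cd_rem s :\: active s)
    (fun e => if e \in active s then cd_i s else cd_part s e)
    (cd_init s) (cd_theta s) (cd_i s)).
Proof.
move=> inv pu.
have [[i1 i2 i3 [i4 i4'] i5 i6 i7 i8 i9] p1 p2 p3] := inv.
have RE := rem_sub inv.
have AR : active s \subset cd_rem s.
  by apply/subsetP=> e; rewrite in_set => /andP[].
have AE := subset_trans AR RE.
have ID_injA : {in active s &, injective ID}.
  by move=> e f /(subsetP AE) eE /(subsetP AE) fE; apply: ID_inj.
have [LI nI sI] := parallel_updateP ID_injA i4' pu i4 erefl.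
set part' := fun e => _; set s' := CDState _ _ _ _ _ _ _.
have part0 e : e \in active s -> cd_part s e = 0.
  by move=> /(subsetP AR); rewrite i2 => /andP[_ /eqP].
(* Peeled edges move from index 0 to the current one, and both values belong to stage [j]
   onwards. *)
have fromE j : j <= cd_i s -> from_stage part' j = from_stage (cd_part s) j.
  move=> ji; apply/setP=> e; rewrite 2!in_set /part'.
  by case: ifP => // /part0 ->; rewrite eqxx ji orbT.
split; last 3 first; rewrite /s' /= ?fromE //.
- by move=> e /setDP[eR _]; apply: p2.
(* An edge of [K] has at least theta(i+1) butterflies among the remaining edges, so it is not
   active. *)
- move=> k K le coreK; apply/subsetP=> e eK.
  have KR := p3 k K le coreK; have eR := subsetP KR e eK.
  apply/setDP; split=> //; rewrite in_set eR /= negb_and -!leqNgt.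
  rewrite (i5 e eR); apply/orP; right; apply: leq_trans (leq_maxr _ _).
  apply: leq_trans le _; apply: leq_trans (coreK.2 e eK) _.
  exact: butterfly_count_sub.
split=> //=.
- move=> e; rewrite in_setD i2 /part'; case: (boolP (e \in active s)) => // eA.
  by rewrite (gtn_eqF i1) andbF.
- by move=> e; rewrite /part'; case: ifP.
- move=> f fR; have /setDP[fR' _] := fR.
  rewrite sI // i5 // ?leq_maxl //.
  (* With [a] the loss, this is [maxn t (maxn t (x + a) - a) = maxn t x]. *)
  by rewrite (butterfly_countD prio_inj RE ID_injA fR); lia.
- by move=> j ji; rewrite fromE; [apply: i6|case/andP: ji].
- by move=> j ji; rewrite fromE; [apply: i7|case/andP: ji].
- move=> e eE; rewrite /part'; case: ifP => [eA _|_ pe].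
    by rewrite -/part' fromE // p2 // (subsetP AR).
  by rewrite -/part' fromE ?i9.
Qed.

Lemma next_stage_invariant s : peel_invariant s -> active s = set0 ->
  loop_invariant (next_stage s).
Proof.
move=> inv act0; have [[i1 i2 i3 i4 i5 i6 i7 i8 i9] p1 p2 p3] := inv.
(* An inactive support is at least theta(i+1), which exceeds theta(i); so the maximum is the
   count. *)
have ge e : e \in cd_rem s -> cd_theta s (cd_i s).+1 <= count (cd_rem s) e.
  move=> eR; have : e \notin active s by rewrite act0 in_set0.
  by rewrite in_set eR i5 //=; lia.
have fromE : from_stage (cd_part s) (cd_i s).+1 = cd_rem s.
  by apply: (from_stageE inv) => e; rewrite ltnS.
split=> //=; split=> //=.
- by move=> e; apply: leqW.
- by move=> e eR; rewrite i5 //; have := ge e eR; lia.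
- move=> j /andP[j1]; rewrite leq_eqVlt => /orP[/eqP->|ji].
    by rewrite fromE; split=> //; apply: (rem_sub inv).
  by apply: i6; rewrite j1.
- move=> j /andP[j1]; rewrite leq_eqVlt => /orP[/eqP->|ji].
    by rewrite fromE; apply: p3.
  by apply: i7; rewrite j1.
- move=> j /andP[j1]; rewrite ltnS leq_eqVlt => /orP[/eqP-> //|ji].
  by apply: i8; rewrite j1.
Qed.

Lemma peel_end s s' : peel ID s s' -> peel_invariant s ->
  [/\ peel_invariant s', active s' = set0 & cd_i s' = cd_i s].
Proof.
elim=> {s s'} [s act0 inv //|s supp I s' _ pu _ IH inv].
by apply: IH; apply: peel_iter_invariant.
Qed.

Lemma cd_loop_end P tgt s s' : cd_loop ID P tgt s s' ->
  loop_invariant s -> cd_i s <= P.+1 ->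
  [/\ loop_invariant s', cd_i s' <= P.+1 & (cd_rem s' == set0) || (P < cd_i s')].
Proof.
elim=> {s s'} [s stop inv le //|s ub s1 s' _ iP ub_s pe _ IH inv _].
have [inv1 act0 i1] := peel_end pe (open_stage_invariant inv ub_s).
apply: IH; first exact: next_stage_invariant.
by rewrite /= i1 ltnS.
Qed.

Lemma theta_le s j : stage_invariant s -> 1 <= j <= cd_i s ->
  cd_theta s j <= cd_theta s (cd_i s).
Proof.
move=> inv /andP[j1 ji]; have thetaS := inv_theta inv.
elim: (cd_i s) ji thetaS => [|n IHn]; first by case: j j1.
rewrite leq_eqVlt => /orP[/eqP-> //|jn] thetaS.
apply: leq_trans (IHn jn _) _ => [m /andP[m1 mn]|].
  by apply: thetaS; rewrite m1 ltnW.
by apply/ltnW/thetaS; rewrite (leq_trans j1) /=.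
Qed.

Lemma PBNG_CD_end P tgt cd : PBNG_CD E prio ID P tgt cd -> ranges_cover E cd ->
  loop_invariant cd /\ {in E, forall e, 1 <= cd_part cd e <= P}.
Proof.
move=> /cd_loop_end/(_ cd_start_invariant isT)[inv iP _] cover; split=> // e eE.
apply/andP; split; last by have := loop_part inv e; lia.
(* An edge left over would lie in the core of the last threshold, which exceeds [theta_max] because
   the ranges cover it. *)
rewrite lt0n; apply/negP=> p0.
have [j /andP[j1 ji] /andP[_]] := cover _ (leqnn _).
have jl : 1 <= j.+1 <= cd_i cd by [].
have := theta_le inv jl.
have eR : e \in from_stage (cd_part cd) (cd_i cd) by rewrite in_set eE p0.
have ii : 1 <= cd_i cd <= cd_i cd by rewrite (inv_i inv) leqnn.
have := core_wing_number (inv_core inv ii) eR.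
have : wing_number E e <= theta_max E by apply: leq_bigmax_cond.
lia.
Qed.

End Coarse.

(** * Fine-grained decomposition *)

Lemma maxn_subn_subn t x a b :
  maxn t (maxn t (x - a) - b) = maxn t (x - (a + b)).
Proof. by lia. Qed.

Lemma maxn_addn_subn c t x a : c <= t ->
  maxn t (maxn c (x + a) - a) = maxn t x.
Proof. by lia. Qed.

Section Fine.

Variables (U V : finType) (E : {set U * V}) (prio : U + V -> nat).
Hypothesis prio_inj : injective prio.
Local Notation edge := (U * V)%type.
Local Notation vertex := (U + V)%type.
Local Notation bloom := ({set vertex} * {set vertex})%type.
Local Notation links_in := (links_in E prio).
Local Notation count := (@butterfly_count U V).
Implicit Types (H S K : {set edge}) (e f g : edge) (B : bloom) (s : fd_state U V).

(** Distinct blooms touch disjoint links and bloom numbers, so every iteration sees the initial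
    values and the truncated subtractions merge into one. *)
Lemma fd_updatesE (Ei : {set edge}) theta e bs supp (I : be_index U V) :
  uniq bs ->
  let: (supp', I') := foldl (fd_update Ei theta e) (supp, I) bs in
  [/\ forall g B, ((g, B) \in links I') =
        ((g, B) \in links I) && ~~ ((B \in bs) && ((g == e) || (g == twin e B))),
      forall B, bloom_number I' B = bloom_number I B - (B \in bs)
    & {in Ei, forall f, theta <= supp f -> supp' f = maxn theta (supp f -
        \sum_(B <- bs) ((twin e B == f) * (bloom_number I B - 1)
          + [&& (f, B) \in links I, f != e & f != twin e B]))}].
Proof.
elim: bs supp I => [|B bs IHbs] supp I /=.
  move=> _; split=> [g B|B|f _ le]; first by rewrite andbT.
    by rewrite subn0.
  by rewrite big_nil subn0; apply/esym/maxn_idPr.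
case/andP=> BN /IHbs{}IHbs.
set supp1 := fun f => _; set I1 := BEIndex _ _.
move: (IHbs supp1 I1); case: (foldl _ _ _) => supp' I' [linksE numE suppE].
have linksI1 g B' : ((g, B') \in links I1) = ((g, B') \in links I) &&
    ~~ ((B' == B) && ((g == e) || (g == twin e B))).
  rewrite /= !in_setD1 !xpair_eqE; case: (B' == B); case: (g == e);
  by case: (g == twin e B); case: (_ \in _).
split.
- move=> g B'; rewrite linksE linksI1 in_cons -andbA; congr (_ && _).
  by case: eqP => [->|_] //=; rewrite (negPf BN) andbT.
- move=> B'; rewrite numE /= /upd in_cons; case: eqP => [->|_] //=.
  by rewrite (negPf BN) subn0.
move=> f fEi le.
have suppf : supp1 f = maxn theta (supp f - ((twin e B == f) * (bloom_number I B - 1)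
          + [&& (f, B) \in links I, f != e & f != twin e B])).
  rewrite /supp1 [f \in _]in_set !in_setD1 !xpair_eqE eqxx !andbT.
  have -> : (if twin e B \in Ei
      then decr supp theta (twin e B) (bloom_number I B - 1) else supp) f =
      maxn theta (supp f - (twin e B == f) * (bloom_number I B - 1)).
    case: ifP => tE; rewrite /decr /upd ?(eq_sym f).
      by case: eqP => [->|_]; rewrite ?mul1n // mul0n subn0; apply/esym/maxn_idPr.
    case: eqP => [tf|_]; first by rewrite tf fEi in tE.
    by rewrite mul0n subn0; apply/esym/maxn_idPr.
  rewrite andbA [_ && ((f, B) \in _)]andbC [(f != _) && _]andbC.
  case: ifP => _; first by rewrite maxn_subn_subn.
  by rewrite addn0.
rewrite suppE //; last by rewrite suppf leq_maxl.
rewrite suppf big_cons.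
have -> : \sum_(B' <- bs) ((twin e B' == f) * (bloom_number I1 B' - 1)
          + [&& (f, B') \in links I1, f != e & f != twin e B']) =
    \sum_(B' <- bs) ((twin e B' == f) * (bloom_number I B' - 1)
          + [&& (f, B') \in links I, f != e & f != twin e B']).
  rewrite big_seq [RHS]big_seq; apply: eq_bigr => B' B'bs.
  have ne : (B' == B) = false by apply: contraNF BN => /eqP <-.
  by rewrite linksI1 /= /upd ne andbT.
exact: maxn_subn_subn.
Qed.

Section OnePartition.

(* [Ei] is the partition being processed, [Hn] the union of the later ones. *)
Variables (Ei Hn : {set edge}) (thetan : nat).
Hypotheses (EiE : Ei \subset E) (Ei_Hn : [disjoint Ei & Hn]).
Hypothesis coren : is_core E thetan Hn.
Hypothesis topn : {in Ei, forall e, wing_number E e < thetan}.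

Definition alive s : {set edge} := fd_rem s :|: Hn.

(* [c] is the last value output, and theta(i) before the first output. *)
Record fd_invariant c s : Prop := FDInvariant {
  fd_remS : fd_rem s \subset Ei;
  fd_linksE : forall f B, ((f, B) \in links (fd_index s)) =
    ((f, B) \in links_in (alive s)) && (f \in fd_rem s);
  fd_numE : forall B, max_priority_bloom E prio B ->
    bloom_number (fd_index s) B = #|pairs (alive s) B|;
  fd_suppE : {in fd_rem s, forall f, fd_supp s f = maxn c (count (alive s) f)};
  fd_top : forall k K, c < k -> is_core E k K -> K \subset alive s;
  fd_wing : {in fd_rem s, forall f, c <= wing_number E f};
  fd_outE : {in Ei :\: fd_rem s, forall f, fd_out s f = Some (wing_number E f)}
}.

Lemma fd_peel_wing c s e : fd_invariant c s -> e \in fd_rem s ->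
  {in fd_rem s, forall f, fd_supp s e <= fd_supp s f} ->
  {in fd_rem s, forall f, fd_supp s e <= wing_number E f}
  /\ fd_supp s e = wing_number E e.
Proof.
case=> rE _ _ suppE top wing _ eR min.
have eE := subsetP EiE e (subsetP rE e eR).
have AE : alive s \subset E by rewrite subUset (subset_trans rE EiE) coren.1.
have eA : e \in alive s by rewrite in_setU eR.
have ge : {in fd_rem s, forall f, fd_supp s e <= wing_number E f}.
  (* If truncation is in force, the output is again [c] and the earlier bound applies. Otherwise the
     minimum support is a genuine count, and it bounds all alive counts in the partition from
     below. *)
  case: (leqP (count (alive s) e) c) => [le|lt].
    by rewrite (suppE e eR) (maxn_idPl le).
  have mE : fd_supp s e = count (alive s) e.
    by rewrite suppE //; apply/maxn_idPr/ltnW.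
  have coreA k : k <= fd_supp s e -> k <= thetan -> is_core E k (alive s).
    move=> km kn; split=> // f; rewrite in_setU => /orP[fR|fH].
      by have := min f fR; rewrite (suppE f fR); lia.
    apply: leq_trans kn _; apply: leq_trans (coren.2 f fH) _.
    by apply: butterfly_count_sub; apply: subsetUr.
  (* Later edges only guarantee level [thetan], so the core is first taken at the minimum of both
     levels; [topn] then excludes a minimum equal to [thetan]. *)
  have lt_n : fd_supp s e < thetan.
    have := core_wing_number (coreA _ (geq_minl _ thetan) (geq_minr _ _)) eA.
    by have := topn (subsetP rE e eR); lia.
  move=> f fR; apply: core_wing_number (coreA _ (leqnn _) (ltnW lt_n)) _.
  by rewrite in_setU fR.
(* A core certifying a larger wing number would still be alive by [fd_top], giving [e] more
   butterflies than its support. *)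
split=> //; apply/eqP; rewrite eqn_leq ge //= leqNgt; apply/negP=> lt.
have [K coreK eK] := wing_number_core eE.
have lec : c <= fd_supp s e by rewrite suppE // leq_maxl.
have KA := top _ K (leq_ltn_trans lec lt) coreK.
have := leq_trans (coreK.2 e eK) (butterfly_count_sub e KA).
by rewrite leqNgt (leq_ltn_trans _ lt) // suppE // leq_maxr.
Qed.

Lemma fd_step_invariant c s e bs supp I : fd_invariant c s -> e \in fd_rem s ->
  {in fd_rem s, forall f, fd_supp s e <= fd_supp s f} ->
  perm_eq bs (enum (blooms_of (links (fd_index s)) e)) ->
  (supp, I) = foldl (fd_update Ei (fd_supp s e) e) (fd_supp s, fd_index s) bs ->
  fd_invariant (fd_supp s e) (FDState supp I (fd_rem s :\ e)
                    (upd (fd_out s) e (Some (fd_supp s e)))).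
Proof.
move=> inv eR min pbs updE.
have [ge mE] := fd_peel_wing inv eR min.
have [rE linksE numE suppE top wing outE] := inv.
have ubs : uniq bs by rewrite (perm_uniq pbs) enum_uniq.
have in_bs B : (B \in bs) = ((e, B) \in links_in (alive s)).
  by rewrite (perm_mem pbs) mem_enum [B \in _]in_set linksE eR andbT.
have := fd_updatesE Ei (fd_supp s e) e (fd_supp s) (fd_index s) ubs.
rewrite -updE => -[linksE' numE' suppE'].
have AE : alive s \subset E by rewrite subUset (subset_trans rE EiE) coren.1.
have lec : c <= fd_supp s e by rewrite suppE // leq_maxl.
have eHn : e \notin Hn.
  by apply: contraTN (subsetP rE e eR) => eHn; rewrite (disjointFl Ei_Hn).
set s' := FDState _ _ _ _.
have aliveE : alive s' = alive s :\: [set e].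
  apply/setP=> f; rewrite !in_setD !in_setU in_setD !in_set1.
  by case: eqP => [->|] //=; rewrite (negPf eHn).
(* Sequential removal is the case of a singleton [S], where the tie-break never occurs and a
   constant ID will do. *)
have ID_inj : {in [set e] &, injective (fun=> 0%R : int)}.
  by move=> f g /set1P -> /set1P ->.
have handledE f B : ((f, B) \in handled E prio (fun=> 0%R) (alive s) [set e]) =
    ((f, B) \in links_in (alive s)) && (f == e).
  rewrite [LHS]in_set in_set1 /=.
  case: (boolP ((f, B) \in _)) => //= /links_inP[mB fB _ _].
  case: eqP => //= fe; rewrite /handles -fe in_set1.
  by rewrite (twin_neq (max_priority_bloomW mB)).
split.
- by apply: subset_trans rE; apply: subD1set.
- move=> f B; rewrite /= linksE' linksE aliveE in_bs.
  rewrite (links_inD _ _ _ ID_inj) !handledE in_setD1.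
  case: (boolP ((f, B) \in _)) => //= lB; rewrite (links_in_twin lB) /=.
  have [mB fB _ _] := links_inP _ _ _ _ _ lB; have pB := max_priority_bloomW mB.
  case: (f =P e) => [fe|/eqP fe] /=; first by rewrite -fe lB andbF.
  rewrite andbC; case: (boolP (f \in _)) => //= fR; rewrite ?andbF ?andbT //.
  case: (f =P twin e B) => [fte|fte].
    rewrite andbT; case: (boolP ((e, B) \in _)) => [leB|lN] /=.
      have [_ eB _ _] := links_inP _ _ _ _ _ leB.
      by rewrite fte (twinK pB) // eqxx.
    by apply/esym; apply: contraNneq lN => <-; apply: links_in_twin.
  rewrite andbF /=; apply/esym/eqP=> tfe; case: fte.
  by rewrite -tfe (twinK pB).
- move=> B mB; rewrite /= numE' numE // aliveE (card_pairsD _ ID_inj mB).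
  suff -> : #|handlers E prio (fun=> 0%R) (alive s) [set e] B| = (B \in bs).
    by rewrite addnK.
  rewrite in_bs; case: (boolP ((e, B) \in _)) => lB.
    rewrite -[RHS]/1 -(cards1 e); apply: eq_card => f.
    rewrite in_handlers handledE in_set1 andbC.
    by case: eqP => // ->.
  apply: eq_card0 => f; rewrite in_handlers handledE.
  by apply/negP=> /andP[lf /eqP fe]; rewrite -fe lf in lB.
- move=> f /setD1P[fe fR]; rewrite /= suppE' ?(subsetP rE) //; last exact: min.
  have fA : f \in alive s :\: [set e] by rewrite in_setD in_set1 fe in_setU fR.
  rewrite (suppE f fR) aliveE (butterfly_countD prio_inj AE ID_inj fA).
  have -> : \sum_(l in handled E prio (fun=> 0%R) (alive s) [set e])
        pair_loss E prio (alive s) [set e] l.1 l.2 f =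
      \sum_(B <- bs) ((twin e B == f) * (bloom_number (fd_index s) B - 1)
          + [&& (f, B) \in links (fd_index s), f != e & f != twin e B]).
    rewrite (eq_bigl (fun l => (l \in links_in (alive s)) && (l.1 == e))); last first.
      by case=> g B; apply: handledE.
    rewrite (perm_big _ pbs) /= big_enum_cond /=.
    rewrite (reindex_onto (fun B => (e, B)) (fun l => l.2)) /=; last first.
      by case=> g B /andP[_ /eqP /= ->].
    apply: eq_big => [B|B].
      by rewrite [B \in _]in_set linksE eR !eqxx !andbT.
    move=> /andP[/andP[lB _] _]; rewrite /pair_loss /=.
    have [mB eB _ _] := links_inP _ _ _ _ _ lB; have pB := max_priority_bloomW mB.
    rewrite numE // linksE fR andbT !in_set1 fe andbT /=; congr (_ + nat_of_bool _).
    case: (boolP ((f, B) \in _)) => //= /links_inP[_ fB _ _]; congr negb.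
    by apply/eqP/eqP=> [<-|->]; rewrite (twinK pB).
  exact: maxn_addn_subn.
- move=> k K ltk coreK; have KA := top k K (leq_ltn_trans lec ltk) coreK.
  rewrite aliveE; apply/subsetP=> f fK; apply/setDP; split; first exact: (subsetP KA).
  apply/set1P=> fe; rewrite fe in fK.
  have := leq_trans (coreK.2 e fK) (butterfly_count_sub e KA).
  by rewrite leqNgt (leq_ltn_trans _ ltk) // suppE // leq_maxr.
- by move=> f /setD1P[_ fR]; apply: ge.
- move=> f; rewrite in_setD in_setD1 negb_and negbK /= /upd => /andP[/orP[/eqP->|fR] fEi].
    by rewrite eqxx mE.
  by case: eqP => [->|_]; rewrite ?mE // outE // in_setD fR.
Qed.

Lemma fd_loop_wing c s s' : fd_loop Ei s s' -> fd_invariant c s ->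
  {in Ei, forall e, fd_out s' e = Some (wing_number E e)}.
Proof.
move=> run; elim: run c => {s s'}
  [s rem0 c inv|s e bs supp I s' eR min pbs updE _ IH c inv].
  by move=> e eEi; apply: (fd_outE inv); rewrite in_setD rem0 in_set0.
by apply: IH; apply: fd_step_invariant inv eR min pbs updE.
Qed.

End OnePartition.

Lemma fd_loop_exists (Ei : {set edge}) s : exists s', fd_loop Ei s s'.
Proof.
have [n] := ubnP #|fd_rem s|; elim: n s => // n IHn s lt_n.
case: (set_0Vmem (fd_rem s)) => [rem0|[e0 e0R]]; first by exists s; apply: FDDone.
have [e eR min] : exists2 e, e \in fd_rem s &
    forall f, f \in fd_rem s -> fd_supp s e <= fd_supp s f.
  by case: (@arg_minnP _ e0 [in fd_rem s] (fd_supp s) e0R) => e; exists e.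
set bs := enum (blooms_of (links (fd_index s)) e).
case updE : (foldl (fd_update Ei (fd_supp s e) e) (fd_supp s, fd_index s) bs) => [supp I].
have [|s' run] := IHn (FDState supp I (fd_rem s :\ e)
                    (upd (fd_out s) e (Some (fd_supp s e)))).
  by move: lt_n; rewrite (cardsD1 e) eR.
by exists s'; apply: FDPeel eR min (perm_refl _) (esym updE) run.
Qed.

Lemma fd_start_wing cd i s : loop_invariant E prio cd ->
  {in E, forall e, 0 < cd_part cd e} ->
  fd_loop (cd_partition E cd i) (fd_start E prio cd i) s ->
  0 < i < cd_i cd ->
  {in cd_partition E cd i, forall e, fd_out s e = Some (wing_number E e)}.
Proof.
move=> inv part_gt0 run /andP[i0 i_lt].
have partE e : (e \in cd_partition E cd i) = (e \in E) && (cd_part cd e == i).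
  by rewrite in_set.
have fromE j e : (e \in from_stage E (cd_part cd) j) = (e \in E) && (j <= cd_part cd e).
  by rewrite in_set; case: (boolP (e \in E)) => //= /part_gt0; case: (cd_part cd e).
have EiE : cd_partition E cd i \subset E.
  by apply/subsetP=> e; rewrite partE => /andP[].
have disj : [disjoint cd_partition E cd i & from_stage E (cd_part cd) i.+1].
  apply/pred0P=> e /=; rewrite partE fromE.
  by case: (e \in E) => //=; case: eqP => // ->; rewrite ltnn.
have splitE : cd_partition E cd i :|: from_stage E (cd_part cd) i.+1 =
    from_stage E (cd_part cd) i.
  apply/setP=> e; rewrite in_setU partE !fromE -andb_orr.
  by rewrite [RHS](congr1 _ (leq_eqVlt _ _)) (eq_sym i).
have i_in : 1 <= i <= cd_i cd by rewrite i0 ltnW.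
have i1_in : 1 <= i.+1 <= cd_i cd by [].
have core0 := inv_core inv i_in; have top0 := inv_top inv i_in.
have coren := inv_core inv i1_in; have topn := inv_top inv i1_in.
(* A core of level at least theta(i+1) lies in the later partitions by [inv_top], so it misses
   [e]. *)
have lt_n : {in cd_partition E cd i, forall e,
    wing_number E e < cd_theta cd i.+1}.
  move=> e; rewrite partE => /andP[eE /eqP pe]; rewrite ltnNge; apply/negP=> le.
  have [K coreK eK] := wing_number_core eE.
  by have := subsetP (topn _ K le coreK) e eK; rewrite fromE pe ltnn andbF.
rewrite -splitE in core0 top0.
apply: (fd_loop_wing EiE disj coren lt_n run (c := cd_theta cd i)).
have aliveE : alive (from_stage E (cd_part cd) i.+1) (fd_start E prio cd i) =
    from_stage E (cd_part cd) i by [].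
split; rewrite ?aliveE //=.
- move=> f B; rewrite [LHS]in_set [X in X && _]in_set /= partE.
  apply/idP/idP.
    case/and3P=> /andP[mB fB] /eqP pf ptf.
    have pB := max_priority_bloomW mB; have /subsetP sE := bloom_edges_sub pB.
    rewrite sE // pf eqxx !andbT; apply/links_inP; split=> //.
      by rewrite fromE sE // pf leqnn.
    by rewrite fromE ptf andbT sE // (twin_edge pB).
  case/andP=> /links_inP[mB fB _]; rewrite fromE => /andP[_ ptf] /andP[_ pf].
  by rewrite mB fB pf ptf.
- move=> B mB; have pB := max_priority_bloomW mB.
  have /subsetP sE := bloom_edges_sub pB.
  suff -> : pairs (from_stage E (cd_part cd) i) B =
    [set [set e; twin e B] | e in bloom_edges B &
       (i <= cd_part cd e) && (i <= cd_part cd (twin e B))] by [].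
  apply/setP=> p; apply/pairsP/imsetP=> -[e].
    rewrite !fromE => -[eB /andP[_ ep] /andP[_ tp]] ->; exists e => //.
    by rewrite [e \in _]in_set; apply/and3P.
  rewrite [e \in _]in_set => /and3P[eB ep tp] ->; exists e => //.
  by rewrite !fromE ep tp !sE //; apply: (twin_edge pB).
(* The initial FD support is a count in a theta(i)-core, hence unchanged by the maximum with
   theta(i). *)
- move=> f; rewrite partE => /andP[fE /eqP pf].
  rewrite (inv_init inv) ?part_gt0 // pf; apply/esym/maxn_idPr.
  by rewrite -splitE; apply: core0.2; rewrite in_setU partE fE pf eqxx.
- by move=> k K lt; rewrite -splitE; apply: top0; apply: ltnW.
- move=> f fi; apply: core_wing_number core0 _.
  by rewrite in_setU fi.
- by move=> f; rewrite setDv in_set0.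
Qed.

End Fine.

(** * Existence of a covering run *)

Section Existence.

Variables (U V : finType) (E : {set U * V}) (prio : U + V -> nat).
Variable ID : U * V -> int.
Local Notation count := (@butterfly_count U V).

(** The target is the entire workload: an edge above [ub] would have positive support, and its share
    would be missing from the sum. *)
Lemma theta_ub_total (s : cd_state U V) :
  cd_rem s != set0 ->
  exists2 ub, is_theta_ub s ((\sum_(e in cd_rem s) cd_supp s e)%:R)%R ub &
    {in cd_rem s, forall e, cd_supp s e <= ub}.
Proof.
case/set0Pn=> e0 e0R; set T := \sum_(_ in _) _.
have full e : e \in cd_rem s -> {in cd_rem s, forall f, cd_supp s f <= cd_supp s e} ->
    workload s (cd_supp s e) = T.
  by move=> eR max; apply: eq_bigl => f; case: (boolP (f \in _)) => // /max ->.
have [e1 e1R max1] : exists2 e, e \in cd_rem s &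
    {in cd_rem s, forall f, cd_supp s f <= cd_supp s e}.
  by case: (@arg_maxnP _ e0 [in cd_rem s] (cd_supp s) e0R) => e; exists e.
pose Q e := (e \in cd_rem s) && (T <= workload s (cd_supp s e)).
have Q1 : Q e1 by rewrite /Q e1R full // leqnn.
have [e /andP[eR Te] min] := arg_minnP (cd_supp s) Q1.
exists (cd_supp s e).
  split; first by exists e.
    by rewrite Num.Theory.ler_nat.
  by move=> f fR; rewrite Num.Theory.ler_nat => Tf; apply: min; rewrite /Q fR.
move=> f fR; rewrite leqNgt; apply/negP=> lt.
move: Te; rewrite /T (bigID (fun g => cd_supp s g <= cd_supp s e)) /=.
rewrite -/(workload s _) [X in _ + X](bigD1 f) /=; last by rewrite fR -ltnNge.
lia.
Qed.

(** With the total workload as target, a single peeling iteration takes every edge into the first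
    partition. Its range covers all wing numbers, since they are bounded by butterfly counts. *)
Lemma PBNG_CD_exists P : 1 <= P -> E != set0 ->
  exists tgt cd, PBNG_CD E prio ID P tgt cd /\ ranges_cover E cd.
Proof.
move=> P_gt0 E0.
have [ub ub_s le_ub] := @theta_ub_total (cd_start E prio) E0.
set s1 := open_stage (cd_start E prio) ub.
have actE : active s1 = E.
  apply/setP=> e; rewrite in_set /=; case: (boolP (e \in E)) => //= eE.
  exact: le_ub.
have [sh run] := interleave_exists ID (active s1) 0
  (bloom_number (BE_Index E prio))
  (fun e => if e \in active s1 then [:: Start U V] else [::])
  (Shared (cd_supp s1) (links (BE_Index E prio)) (fun=> 0)).
have := ParallelUpdate (I := BE_Index E prio) run.
set supp := sh_supp sh; set I := BEIndex _ _ => pu.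
pose s2 := CDState supp I (cd_rem s1 :\: active s1)
   (fun e => if e \in active s1 then cd_i s1 else cd_part s1 e)
   (cd_init s1) (cd_theta s1) (cd_i s1).
have rem2 : cd_rem s2 = set0 by rewrite /= actE setDv.
exists (fun=> ((\sum_(e in E) count E e)%:R)%R), (next_stage s2); split.
  apply: CDStage ub_s _ _ => //.
    apply: PeelIter pu _; first by rewrite actE.
    by apply: PeelDone; apply/setP=> e; rewrite in_set rem2 !in_set0.
  by apply: CDDone; rewrite [cd_rem _]rem2 eqxx.
move=> t le_t; exists 1 => //=; rewrite ltnS (leq_trans le_t) //.
apply/bigmax_leqP => e eE; apply: leq_trans (le_ub e eE).
have [K [KE deg] eK] := wing_number_core eE.
exact: leq_trans (deg e eK) (butterfly_count_sub e KE).
Qed.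

End Existence.

Theorem theorem2 (U V : finType) (E : {set U * V}) (prio : U + V -> nat)
    (ID : U * V -> int) (P : nat) :
  degree_priority E prio ->
  {in E &, injective ID} ->
  1 <= P ->
  (E != set0 -> exists tgt cd,
     PBNG_CD E prio ID P tgt cd /\ ranges_cover E cd) /\
  (forall (tgt : nat -> rat) cd,
     PBNG_CD E prio ID P tgt cd -> ranges_cover E cd ->
     (exists out, PBNG_FD E prio P cd out) /\
     (forall out, PBNG_FD E prio P cd out ->
        forall e, e \in E -> out e = Some (wing_number E e))).
Proof.
move=> [prio_inj _] ID_inj P_gt0; split; first exact: PBNG_CD_exists.
move=> tgt cd run cover.
have [inv partP] := PBNG_CD_end prio_inj ID_inj run cover.
have part_gt0 : {in E, forall e, 0 < cd_part cd e}.
  by move=> e /partP/andP[].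
have wingP i s : 1 <= i <= P ->
    fd_loop (cd_partition E cd i) (fd_start E prio cd i) s ->
    {in cd_partition E cd i, forall e, fd_out s e = Some (wing_number E e)}.
  move=> /andP[i0 _] runi e ei.
  apply: (fd_start_wing prio_inj inv part_gt0 runi _ ei).
  have := ei; rewrite in_set => /andP[_ /eqP <-].
  by rewrite (loop_part inv) andbT; move: ei; rewrite in_set => /andP[/part_gt0].
split.
  (* By [wingP] every FD run outputs wing numbers, so this function agrees with whichever runs are
     chosen. *)
  exists (fun e => if 1 <= cd_part cd e <= P then Some (wing_number E e) else None).
  split=> [i iP|e /negPf-> //].
  have [s runi] := fd_loop_exists (cd_partition E cd i) (fd_start E prio cd i).
  exists s => // e ei; rewrite (wingP i s iP runi e ei).
  by move: ei; rewrite in_set => /andP[_ /eqP->]; rewrite iP.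
move=> out [outP _] e eE.
have [s runi outE] := outP _ (partP e eE).
have ei : e \in cd_partition E cd (cd_part cd e) by rewrite in_set eE eqxx.
by rewrite outE // (wingP _ _ (partP e eE) runi).
Qed.
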